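(* Let $b = 2^i 3^j$ with integers $i, j \ge 0$, $i + j > 0$, and $b < 10^{12}$. If $r$ is an integer with $2 \le r < b$ and $r \mid b$, then $D(b, r) = f(b) + 1$.
   Context: For a positive integer $n$, the complexity $f(n)$ is the least number of $1$'s needed to write $n$ as an expression using only the constant $1$, an arbitrary number of additions $+$, multiplications $*$, and parentheses (e.g. $f(6) \le 5$ since $6 = (1+1)(1+1+1)$). For integers $b \ge 1$ and $r \ge 0$, $D(b, r)$ denotes the smallest integer such that $f(r + bn) \le f(n) + D(b, r)$ holds for all positive integers $n$. *)

(* Defs.v *)
From mathcomp Require Import all_boot all_order all_algebra.
From Stdlib Require Import ClassicalEpsilon.
Set Implicit Arguments. Unset Strict Implicit. Unset Printing Implicit Defensive.

Inductive expr : Type :=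
| One : expr
| Add : expr -> expr -> expr
| Mul : expr -> expr -> expr.

Fixpoint eval (e : expr) : nat :=
  match e with
  | One => 1
  | Add a b => eval a + eval b
  | Mul a b => eval a * eval b
  end.

Fixpoint ones (e : expr) : nat :=
  match e with
  | One => 1
  | Add a b => ones a + ones b
  | Mul a b => ones a + ones b
  end.

Definition writable (n k : nat) : bool :=
  if excluded_middle_informative (exists e, eval e = n /\ ones e = k)
  then true else false.

Fixpoint unary (n : nat) : expr :=
  match n with
  | 0 | 1 => One
  | m.+1 => Add (unary m) One
  end.

Lemma unary_eval n : 0 < n -> eval (unary n) = n /\ ones (unary n) = n.
Proof.
elim: n => [//|[|m] IH _] //=.
by have [-> ->] := IH isT; rewrite !addn1.
Qed.

Lemma writable_ex n : 0 < n -> exists k, writable n k.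
Proof.
move=> n0; exists n; rewrite /writable.
case: excluded_middle_informative => // H; exfalso; apply: H.
by exists (unary n); apply: unary_eval.
Qed.

(* integer complexity f(n): least number of 1's needed to write n
   (for n = 0, which has no expression, the value 0 is a dummy) *)
Definition f (n : nat) : nat :=
  match ltnP 0 n with
  | LtnNotGeq n0 => ex_minn (writable_ex n0)
  | _ => 0
  end.

Definition is_D (b r : nat) (d : int) : Prop :=
  (forall n : nat, 0 < n -> ((f (r + b * n))%:Z <= (f n)%:Z + d)%R) /\
  (forall d' : int,
     (forall n : nat, 0 < n -> ((f (r + b * n))%:Z <= (f n)%:Z + d')%R) ->
     (d <= d')%R).

(* Main.v *)
(** Write [rho n = 3 ^ f n / n ^ 3].  It is at least 1 and multiplicative along optimal
    products, and an optimal sum [x + v] with [x] large costs a factor [3 ^ f v], so that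
    [v] is tiny when [rho] is bounded.

    First, [f (2 ^ i * 3 ^ k) = 2 i + 3 k] for [i < 40].  A minimal counterexample is an
    optimal sum [x + v] with [v <= 3] and [rho x] at most [(9/8) ^ 39 / 9 < 11].  Numbers
    with so small a [rho] arise from 3-smooth numbers by multiplications and few small
    additions, and none of them equals [2 ^ i * 3 ^ k - v], by congruences when [k > 0] and
    by a finite check when [k = 0].  As [f] is thus additive on the factorisation
    [b = r c], the upper bound follows from [r + b n = r (1 + c n)].

    For the lower bound take [n = 3 ^ m] with [m] large.  Numbers of bounded [rho] are sums
    of boundedly many powers of 3.  Hence in an optimal product equal to [A 3 ^ m + B] one
    factor [u] is bounded and divides both [A 3 ^ G] and [B], and an optimal sum has a
    summand [v <= B]; induction on [B] gives
    [f (A 3 ^ m + B) >= 3 m + 1 + min_k (f (A 3 ^ k) - 3 k)]. *)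

From Stdlib Require Import ClassicalEpsilon NArith.
Require Import Defs.
From mathcomp Require Import all_boot all_order all_algebra.
From mathcomp Require Import zify ring lra.
Set Implicit Arguments. Unset Strict Implicit. Unset Printing Implicit Defensive.
Import Order.TTheory GRing.Theory Num.Theory.

(** * Integer complexity *)

Lemma writableP n k :
  reflect (exists e, eval e = n /\ ones e = k) (writable n k).
Proof.
by rewrite /writable; case: excluded_middle_informative => expr_ex; constructor.
Qed.

Lemma eval_gt0 e : 0 < eval e.
Proof.
by elim: e => //= a a_gt0 b b_gt0; rewrite ?addn_gt0 ?muln_gt0 a_gt0 ?b_gt0.
Qed.

Lemma ones_gt0 e : 0 < ones e.
Proof. by elim: e => //= a a_gt0 b _; rewrite addn_gt0 a_gt0. Qed.

Lemma f_attained n : 0 < n -> exists e, eval e = n /\ ones e = f n.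
Proof.
rewrite /f; case: ltnP => // n_gt0 _.
by case: ex_minnP => k /writableP[e [? ?]] _; exists e.
Qed.

Lemma f_eval_le e : f (eval e) <= ones e.
Proof.
rewrite /f; case: ltnP => [n_gt0|] //.
by case: ex_minnP => k _; apply; apply/writableP; exists e.
Qed.

Lemma f_gt0 n : 0 < n -> 0 < f n.
Proof. by move=> /f_attained[e [_ <-]]; exact: ones_gt0. Qed.

Lemma f_add_le m n : 0 < m -> 0 < n -> f (m + n) <= f m + f n.
Proof.
move=> /f_attained[a [<- <-]] /f_attained[b [<- <-]].
exact: (f_eval_le (Add a b)).
Qed.

Lemma f_mul_le m n : 0 < m -> 0 < n -> f (m * n) <= f m + f n.
Proof.
move=> /f_attained[a [<- <-]] /f_attained[b [<- <-]].
exact: (f_eval_le (Mul a b)).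
Qed.

Lemma f_le_id n : 0 < n -> f n <= n.
Proof. by move=> /unary_eval[evalE onesE]; rewrite -{1}evalE -{2}onesE f_eval_le. Qed.

Variant optimal_split (P : pred nat) (n : nat) : Prop :=
| OptimalSum x v of 0 < v & v <= x & n = x + v & f n = f x + f v
| OptimalProduct s t of P s & P t & n = s * t & f n = f s + f t.

Lemma f_optimal_split n : 1 < n -> optimal_split (ltn 1) n.
Proof.
move=> n_gt1; have [[|a b|a b] /= [nE fnE]] := f_attained (ltnW n_gt1).
- by rewrite -nE in n_gt1.
- have fsum : f n = f (eval a) + f (eval b).
    by apply/eqP; rewrite eqn_leq -{1}nE f_add_le ?eval_gt0 //= -fnE leq_add ?f_eval_le.
  have [le_ba|/ltnW le_ab] := leqP (eval b) (eval a).
    exact: (OptimalSum _ (eval_gt0 b) le_ba (esym nE)).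
  by apply: (OptimalSum _ (eval_gt0 a) le_ab); rewrite addnC.
- have fprod : f n = f (eval a) + f (eval b).
    by apply/eqP; rewrite eqn_leq -{1}nE f_mul_le ?eval_gt0 //= -fnE leq_add ?f_eval_le.
  (* A factor 1 would be superfluous, whereas [f n] counts the ones of both factors. *)
  have factor_gt1 c d : eval c * eval d = n -> ones c + ones d = f n -> 1 < eval d.
    move=> <- fcd; rewrite ltn_neqAle eval_gt0 andbT eq_sym; apply/eqP => d1.
    by have := f_eval_le c; have := ones_gt0 d; rewrite d1 muln1 in fcd; lia.
  have b_gt1 := factor_gt1 a b nE fnE.
  have a_gt1 : 1 < eval a by apply: (factor_gt1 b a); rewrite 1?mulnC // addnC.
  exact: (OptimalProduct a_gt1 b_gt1 (esym nE)).
Qed.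

Lemma cube_succ_le x p : 0 < x -> 0 < p -> x ^ 3 <= 3 ^ p -> (x + 1) ^ 3 <= 3 ^ p.+1.
Proof.
rewrite [3 ^ p.+1]expnS; case: x => [|[|[|x]]] // _ p_gt0 cube_le.
- by apply: (@leq_trans (3 * 3 ^ 1)); rewrite // leq_mul2l leq_exp2l.
- apply: (@leq_trans (3 * 3 ^ 2)); rewrite // leq_mul2l leq_exp2l //.
  by case: p p_gt0 cube_le => [|[]].
apply: (@leq_trans (3 * x.+3 ^ 3)); last by rewrite leq_mul2l cube_le orbT.
by rewrite addn1 !expnS !expn0; nia.
Qed.

Lemma cube_eval_le e : eval e ^ 3 <= 3 ^ ones e.
Proof.
elim: e => //= a a_le b b_le; last by rewrite expnMn expnD leq_mul.
wlog le_ba : a b a_le b_le / eval b <= eval a => [wl|].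
  have [le_ba|/ltnW le_ab] := leqP (eval b) (eval a); first exact: wl.
  by rewrite addnC [ones a + _]addnC wl.
have [b1|] := eqVneq (eval b) 1.
  rewrite b1 (leq_trans (cube_succ_le (eval_gt0 a) (ones_gt0 a) a_le)) //.
  by rewrite leq_exp2l // -addn1 leq_add2l ones_gt0.
rewrite expnD neq_ltn ltnNge eval_gt0 => b_gt1; apply: leq_trans (leq_mul a_le b_le).
by rewrite -expnMn leq_exp2r //; nia.
Qed.

Lemma cube_le_exp_f n : n ^ 3 <= 3 ^ f n.
Proof.
case: (posnP n) => [-> //|/f_attained[e [<- <-]]].
exact: cube_eval_le.
Qed.

Lemma lt_f_of_cube n k : 3 ^ k < n ^ 3 -> k < f n.
Proof.
by move=> lt_cube; rewrite -(@ltn_exp2l 3) // (leq_trans lt_cube) // cube_le_exp_f.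
Qed.

Lemma f_id n : 0 < n <= 5 -> f n = n.
Proof.
case/andP=> n_gt0 n_le5; apply/eqP; rewrite eqn_leq f_le_id //.
by case: n n_gt0 n_le5 => [|[|[|[|[|[|]]]]]] // _ _; rewrite ?f_gt0 ?lt_f_of_cube.
Qed.

Lemma f_expn_mul_le p k n : 0 < p -> 0 < n -> f (p ^ k * n) <= p * k + f n.
Proof.
move=> p_gt0 n_gt0; elim: k => [|k IHk]; first by rewrite mul1n muln0.
rewrite expnS -mulnA mulnS -addnA; apply: leq_trans (f_mul_le _ _) _ => //.
  by rewrite muln_gt0 expn_gt0 p_gt0.
exact: leq_add (f_le_id p_gt0) IHk.
Qed.

Lemma f_smooth_le a b : 0 < a + b -> f (2 ^ a * 3 ^ b) <= 2 * a + 3 * b.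
Proof.
case: b => [|b] ab_gt0.
  case: a ab_gt0 => // a _; rewrite muln1 expnSr [2 * _]mulnSr muln0 addn0.
  by rewrite (leq_trans (f_expn_mul_le _ _ _)) // leq_add2l f_le_id.
apply: leq_trans (f_expn_mul_le _ _ _) _; rewrite ?expn_gt0 // leq_add2l.
rewrite expnSr [3 * _]mulnSr.
by rewrite (leq_trans (f_expn_mul_le _ _ _)) // leq_add2l f_le_id.
Qed.

(** * Defects *)

(* Sealed, so that conversion never unfolds the normalisation of fractions. *)
Definition Qf : realFieldType. Proof. exact: rat. Qed.

(* The defect of [n] is [f n - 3 log_3 n], and [rho n] is 3 to that power. *)
Definition rho (n : nat) : Qf := (3%:R ^+ f n / n%:R ^+ 3)%R.

Lemma le_rho_of_f k n : k <= f n -> (3%:R ^+ k / n%:R ^+ 3 <= rho n)%R.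
Proof.
move=> le_kf; rewrite /rho ler_wpM2r ?invr_ge0 ?exprn_ge0 ?ler0n //.
by rewrite ler_eXn2l ?ltr1n.
Qed.

Lemma rho_ge1 n : 0 < n -> (1 <= rho n)%R.
Proof.
move=> n_gt0; rewrite /rho ler_pdivlMr ?exprn_gt0 ?ltr0n // mul1r.
by rewrite -!natrX ler_nat cube_le_exp_f.
Qed.

Lemma rho_mul n x y : n = x * y -> f n = f x + f y -> rho n = (rho x * rho y)%R.
Proof. by move=> nE fnE; rewrite /rho fnE nE natrM exprD exprMn invfM mulrACA. Qed.

Lemma rho_mul_ge n x y (c : Qf) : n = x * y -> f n = f x + f y -> (0 <= c)%R ->
  (c <= rho x)%R -> (c <= rho y)%R -> (c ^+ 2 <= rho n)%R.
Proof. by move=> nE fnE *; rewrite (rho_mul nE fnE) expr2 ler_pM. Qed.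

Lemma rho_add x v : 0 < x -> f (x + v) = f x + f v ->
  (rho (x + v) * (x + v)%:R ^+ 3 = rho x * 3%:R ^+ f v * x%:R ^+ 3)%R.
Proof.
move=> x_gt0 fxv; rewrite /rho fxv.
have cube_neq0 n : 0 < n -> (n%:R ^+ 3 != 0 :> Qf)%R.
  by move=> n_gt0; rewrite expf_neq0 // pnatr_eq0 -lt0n.
by rewrite divfK ?cube_neq0 ?addn_gt0 ?x_gt0 // exprD [in RHS]mulrAC divfK ?cube_neq0.
Qed.

Lemma rho_summand_le x v (c : Qf) : 0 < x -> f (x + v) = f x + f v ->
  ((x + v)%:R <= c * x%:R)%R -> (rho x * 3%:R ^+ f v <= rho (x + v) * c ^+ 3)%R.
Proof.
move=> x_gt0 fxv xv_le; have n_gt0 : 0 < x + v by rewrite addn_gt0 x_gt0.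
have cube_gt0 : (0 < x%:R ^+ 3 :> Qf)%R by rewrite exprn_gt0 // ltr0n.
rewrite -(ler_pM2r cube_gt0) -rho_add // -[leRHS]mulrA -exprMn.
rewrite ler_wpM2l ?(le_trans ler01) ?rho_ge1 //.
by rewrite lerXn2r ?nnegrE ?(le_trans _ xv_le) ?ler0n.
Qed.

Lemma rho_summand_le_nat x v q : 0 < q <= x -> f (x + v) = f x + f v ->
  (rho x * 3%:R ^+ f v <= rho (x + v) * ((q + v)%:R / q%:R) ^+ 3)%R.
Proof.
case/andP=> q_gt0 le_qx fxv; apply: rho_summand_le => //; first exact: leq_trans le_qx.
rewrite mulrAC ler_pdivlMr ?ltr0n // -!natrM ler_nat.
by rewrite mulnC mulnDr mulnDl leq_add2l mulnC leq_mul2l le_qx orbT.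
Qed.

(* [rho x >= 1] and [3 ^ f v >= v ^ 3], so the cube of [x v / (x + v)] is at most
   [rho (x + v)]. *)
Lemma rho_sum_bound x v p q : 0 < x -> 0 < q -> f (x + v) = f x + f v ->
  (rho (x + v) <= (p%:R / q%:R) ^+ 3)%R -> q * (x * v) <= p * (x + v).
Proof.
move=> x_gt0 q_gt0 fxv rho_le.
have : ((x * v)%:R ^+ 3 <= (p%:R / q%:R * (x + v)%:R) ^+ 3 :> Qf)%R.
  rewrite [leRHS]exprMn; apply: le_trans (ler_wpM2r _ rho_le); last first.
    by rewrite exprn_ge0 ?ler0n.
  rewrite rho_add // natrM exprMn mulrC ler_wpM2r ?exprn_ge0 ?ler0n //.
  apply: le_trans (ler_peMl _ (rho_ge1 x_gt0)); last by rewrite exprn_ge0 ?ler0n.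
  by rewrite -!natrX ler_nat cube_le_exp_f.
rewrite ler_pXn2r ?nnegrE ?mulr_ge0 ?invr_ge0 ?ler0n //.
by rewrite mulrAC ler_pdivlMr ?ltr0n // -!natrM ler_nat mulnC.
Qed.

Lemma smooth_ratio a b :
  (3%:R ^+ (2 * a + 3 * b) / (2 ^ a * 3 ^ b)%:R ^+ 3 = (9 / 8) ^+ a :> Qf)%R.
Proof.
have cube_neq0 : (3%:R ^+ (3 * b) != 0 :> Qf)%R by rewrite expf_neq0 ?pnatr_eq0.
rewrite exprD natrM !natrX exprMn -!exprM [b * 3]mulnC [a * 3]mulnC !exprM.
rewrite invfM mulrACA -!exprM divff // mulr1 !exprM -expr_div_n.
by congr (_ ^+ _)%R; lra.
Qed.

Lemma rho_smooth a b : f (2 ^ a * 3 ^ b) = 2 * a + 3 * b ->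
  rho (2 ^ a * 3 ^ b) = ((9 / 8) ^+ a)%R.
Proof. by move=> fE; rewrite /rho fE smooth_ratio. Qed.

Lemma rho_smooth_of_lt a b : f (2 ^ a * 3 ^ b) < 2 * a + 3 * b ->
  (rho (2 ^ a * 3 ^ b) * 3%:R <= (9 / 8) ^+ a)%R.
Proof.
move=> f_lt; rewrite -(smooth_ratio a b) /rho mulrAC -exprSr.
by rewrite ler_wpM2r ?invr_ge0 ?exprn_ge0 ?ler0n // ler_eXn2l ?ltr1n.
Qed.

Lemma lt1_98 : (1 < 9 / 8 :> Qf)%R. Proof. by lra. Qed.

Lemma ltn_exp98 a k (c : Qf) :
  ((9 / 8) ^+ a <= c -> c < (9 / 8) ^+ k -> (a < k)%N)%R.
Proof. by move=> le_c lt_c; rewrite -(ltr_eXn2l lt1_98) (le_lt_trans le_c). Qed.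

Lemma leq_exp98 a b : a <= b -> ((9 / 8) ^+ a <= (9 / 8) ^+ b :> Qf)%R.
Proof. by rewrite (ler_eXn2l lt1_98). Qed.

Lemma f_smooth_lt10 a b : 0 < a + b -> a < 10 -> f (2 ^ a * 3 ^ b) = 2 * a + 3 * b.
Proof.
move=> ab_gt0 a_lt10; apply/eqP; rewrite eqn_leq f_smooth_le //= leqNgt.
apply/negP => /rho_smooth_of_lt rho_le.
have := @rho_ge1 (2 ^ a * 3 ^ b); rewrite muln_gt0 !expn_gt0 => /(_ isT).
by have := leq_exp98 (a_lt10 : a <= 9); lra.
Qed.

(** * Numbers of small defect *)

Lemma low_rho_sum x v : 0 < v <= x -> f (x + v) = f x + f v ->
  (rho (x + v) < 243 / 125)%R -> x + v \in [:: 2; 3; 4; 6].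
Proof.
case/andP=> v_gt0 le_vx fxv rho_lt; have x_gt0 := leq_trans v_gt0 le_vx.
have xv_le : 4 * (x * v) <= 5 * (x + v).
  by apply: (rho_sum_bound x_gt0 _ fxv) => //; lra.
have [x_le6|x_gt6] := leqP x 6; last first.
  have v1 : v = 1 by nia.
  have := rho_summand_le_nat (x_gt6 : 0 < 7 <= x) fxv; rewrite v1 f_id // in rho_lt *.
  by have := rho_ge1 x_gt0; lra.
have : x + v \in [:: 2; 3; 4; 5; 6; 7] by rewrite !inE; nia.
rewrite !inE => /or4P[->|->|->|/or3P[/eqP n5|->|/eqP n7]]; rewrite ?orbT //.
- by move: rho_lt; rewrite n5 /rho f_id //; lra.
- by move: rho_lt; have := le_rho_of_f (@lt_f_of_cube 7 5 isT); rewrite n7; lra.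
Qed.

Lemma low_rho_smooth n : 0 < n -> (rho n < 243 / 125)%R ->
  exists a b, n = 2 ^ a * 3 ^ b /\ f n = 2 * a + 3 * b.
Proof.
elim/ltn_ind: n => n IHn n_gt0 rho_n.
have [n_le1|n_gt1] := leqP n 1.
  by have n1 : n = 1 by [lia]; move: rho_n; rewrite n1 /rho f_id //; lra.
case: (f_optimal_split n_gt1) => [x v v_gt0 le_vx nE fnE|x y x_gt1 y_gt1 nE fnE].
  suff [a [b [-> ab_gt0 a_lt10]]] : exists a b, [/\ n = 2 ^ a * 3 ^ b, 0 < a + b & a < 10].
    by exists a, b; rewrite f_smooth_lt10.
  have := @low_rho_sum x v; rewrite v_gt0 -nE !inE => /(_ le_vx fnE rho_n).
  by case/or4P=> /eqP->; [exists 1, 0|exists 0, 1|exists 2, 0|exists 1, 1].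
have [x_gt0 y_gt0] := (ltnW x_gt1, ltnW y_gt1).
have [rho_x rho_y] := (rho_ge1 x_gt0, rho_ge1 y_gt0).
rewrite (rho_mul nE fnE) in rho_n.
have [||a [b [xE fxE]]] := IHn x _ x_gt0; first by rewrite nE ltn_Pmulr.
  by apply: le_lt_trans rho_n; rewrite ler_peMr // (le_trans ler01).
have [||c [d [yE fyE]]] := IHn y _ y_gt0; first by rewrite nE ltn_Pmull.
  by apply: le_lt_trans rho_n; rewrite ler_peMl // (le_trans ler01).
exists (a + c), (b + d); rewrite fnE fxE fyE; split; last by lia.
by rewrite nE xE yE !expnD mulnACA.
Qed.

Lemma low_rho_exp98 n k : 0 < n -> (rho n < (9 / 8) ^+ k)%R -> k <= 5 ->
  exists a b, [/\ n = 2 ^ a * 3 ^ b, rho n = ((9 / 8) ^+ a)%R & a < k].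
Proof.
move=> n_gt0 rho_n /leq_exp98 le_exp5.
have exp5_lt : ((9 / 8) ^+ 5 < 243 / 125 :> Qf)%R by lra.
have rho_lt := lt_trans (lt_le_trans rho_n le_exp5) exp5_lt.
have [a [b [nE fnE]]] := low_rho_smooth n_gt0 rho_lt.
have rhoE : rho n = ((9 / 8) ^+ a)%R by rewrite nE rho_smooth -?nE.
by exists a, b; split=> //; apply: ltn_exp98 rho_n; rewrite rhoE.
Qed.

Local Notation smooth := (pnat (pred2 2 3)).

Lemma smoothP n : reflect (exists a b, n = 2 ^ a * 3 ^ b) (smooth n).
Proof.
apply: (iffP idP) => [smooth_n|[a [b ->]]]; last by rewrite pnatM !pnatX !pnatE.
exists (logn 2 n), (logn 3 n); have /andP[n_gt0 _] := smooth_n.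
rewrite -!p_part -{1}(@partnC 2 n) //; congr (_ * _); apply: eq_in_partn => p.
by move=> /(pnatPpi smooth_n) /orP[]/eqP->.
Qed.

Lemma odd_smooth n : odd n -> smooth n -> 3.-nat n.
Proof.
move=> odd_n /smoothP[[|a] [b nE]]; first by rewrite nE mul1n pnatX pnat_id.
by move: odd_n; rewrite nE expnS -mulnA oddM.
Qed.

Lemma rho_nonsmooth n : 0 < n -> ~~ smooth n -> (243 / 125 <= rho n)%R.
Proof.
move=> n_gt0; apply: contraNT; rewrite -ltNge => /(low_rho_smooth n_gt0)[a [b [nE _]]].
by apply/smoothP; exists a, b.
Qed.

Lemma rho_odd_nonpow3 n : odd n -> ~~ 3.-nat n -> (243 / 125 <= rho n)%R.
Proof.
move=> odd_n n_npow3; apply: rho_nonsmooth; first exact: odd_gt0.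
by apply: contra n_npow3; exact: odd_smooth.
Qed.

Lemma rho_nonpow3 n : 0 < n -> ~~ 3.-nat n -> (9 / 8 <= rho n)%R.
Proof.
move=> n_gt0; apply: contraNT; rewrite -ltNge -[X in (_ < X)%R]expr1.
move=> /(low_rho_exp98 n_gt0)[]// [|a] [b [-> _ a_lt1]] //.
by rewrite mul1n pnatX pnat_id.
Qed.

Lemma f_pow3 a : 0 < a -> f (3 ^ a) = 3 * a.
Proof. by move=> a_gt0; have := @f_smooth_lt10 0 a; rewrite mul1n; apply. Qed.

Lemma rho_pow3 a : 0 < a -> rho (3 ^ a) = 1%R.
Proof. by move=> a_gt0; have := @rho_smooth 0 a; rewrite mul1n; apply; exact: f_pow3. Qed.

Lemma peel_pnat (pi : nat_pred) n : 0 < n -> ~~ pi.-nat n -> exists m y,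
  [/\ pi.-nat m, n = m * y, 1 < m -> f n = f m + f y, ~~ pi.-nat y &
      optimal_split (fun z => ~~ pi.-nat z) y].
Proof.
elim/ltn_ind: n => n IHn n_gt0 n_npi.
have n_gt1 : 1 < n by case: n n_gt0 n_npi {IHn} => [|[]].
case: (f_optimal_split n_gt1) => [x v v_gt0 le_vx nE fnE|s t s_gt1 t_gt1 nE fnE].
  by exists 1, n; rewrite mul1n; split=> //; exact: OptimalSum nE fnE.
have [/andP[s_npi t_npi]|] := boolP (~~ pi.-nat s && ~~ pi.-nat t).
  by exists 1, n; rewrite mul1n; split=> //; exact: OptimalProduct nE fnE.
rewrite negb_and !negbK => factor_pi.
wlog s_pi : s t s_gt1 t_gt1 nE fnE factor_pi / pi.-nat s => [wl|].
  case/orP: (factor_pi) => [s_pi|t_pi]; first exact: (wl s t).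
  by apply: (wl t s); rewrite ?t_pi // 1?mulnC // addnC.
have t_npi : ~~ pi.-nat t by move: n_npi; rewrite nE pnatM s_pi.
have [|m [y [m_pi tE ftE y_npi y_split]]] := IHn t _ (ltnW t_gt1) t_npi.
  by rewrite nE ltn_Pmull // ltnW.
have [m_gt0 y_gt0] : 0 < m /\ 0 < y by apply/andP; rewrite -muln_gt0 -tE ltnW.
exists (s * m), y; split; rewrite ?pnatM ?s_pi // ?nE ?tE ?mulnA // -mulnA -tE -nE => _.
have [m_gt1|m_le1] := ltnP 1 m; last first.
  by have m1 : m = 1 by [lia]; rewrite m1 muln1 fnE tE m1 mul1n.
have sm_gt0 : 0 < s * m by rewrite muln_gt0 m_gt0 ltnW.
have := f_mul_le (ltnW s_gt1) m_gt0; have := f_mul_le sm_gt0 y_gt0.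
by rewrite -mulnA -tE -nE fnE ftE //; lia.
Qed.

Lemma rho_peel_pow3 n : 0 < n -> ~~ 3.-nat n -> exists e y,
  [/\ n = 3 ^ e * y, rho n = rho y, ~~ 3.-nat y &
      optimal_split (fun z => ~~ 3.-nat z) y].
Proof.
move=> n_gt0 /(peel_pnat n_gt0)[m [y [/p_natP[e ->] nE fnE y_npow3 y_split]]].
exists e, y; split=> //; case: e nE fnE => [-> _|e nE fnE]; first by rewrite mul1n.
by rewrite (rho_mul nE) ?rho_pow3 ?mul1r // fnE // -{1}(expn0 3) ltn_exp2l.
Qed.

(* [2197/200] slightly exceeds [(9/8) ^ 39 / 9].  If the product of two odd factors, neither
   a power of 3, has at most this [rho], then one factor has [rho] at most [663/200], which
   exceeds the square root, and the other at most [283/50], which exceeds the quotient by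
   [243/125].  Likewise [367/100] below slightly exceeds [(9/8) ^ 39 / 27]. *)
Definition odd_cores : seq nat := [:: 5; 7; 13; 19; 55; 163].

Lemma low_rho_odd_succ x : 5 < x -> f (x + 1) = f x + f 1 -> odd (x + 1) ->
  ~~ 3.-nat (x + 1) -> (rho (x + 1) <= 663 / 200)%R -> x + 1 \in odd_cores.
Proof.
move=> x_gt5 fxE odd_x x_npow3 rho_le; have x_gt0 := ltn_trans (isT : 0 < 5) x_gt5.
have rho_x m : 0 < m <= x -> (rho x * 3%:R <= 663 / 200 * ((m + 1)%:R / m%:R) ^+ 3)%R.
  move=> m_bounds; have := rho_summand_le_nat m_bounds fxE; rewrite f_id // expr1.
  by move/le_trans; apply; rewrite ler_wpM2r // exprn_ge0 // divr_ge0 ?ler0n.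
have [|//|a [b [xE rhoE a_lt5]]] := @low_rho_exp98 x 5 x_gt0.
  by have := rho_x 6 x_gt5; lra.
have a_gt0 : 0 < a.
  by case: a xE {rhoE a_lt5} odd_x => // ->; rewrite mul1n oddD oddX orbT.
rewrite {}rhoE in rho_x.
have a_le1 : 24 <= x -> a <= 1.
  move=> x_ge24; rewrite -ltnS; apply: ltn_exp98 (lexx _) _.
  by have := rho_x 24 x_ge24; lra.
have a_le3 : 9 <= x -> a <= 3.
  move=> x_ge9; rewrite -ltnS; apply: ltn_exp98 (lexx _) _.
  by have := rho_x 9 x_ge9; lra.
have x_lt486 : x < 486.
  rewrite ltnNge; apply/negP => x_ge486; have := rho_x 486 x_ge486.
  by have := leq_exp98 a_gt0; lra.
have b_lt6 : b < 6.
  rewrite -(@ltn_exp2l 3) // ltnNge; apply/negP => b_big.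
  by have : 1 * 3 ^ 6 <= x by [rewrite xE leq_mul ?expn_gt0]; lia.
have : [&& x < 486, 5 < x, (24 <= x) ==> (a <= 1), (9 <= x) ==> (a <= 3)
    & ~~ 3.-nat (x + 1)].
  by rewrite x_lt486 x_gt5 x_npow3 andbT /=; apply/andP; split; apply/implyP.
rewrite xE; case: a a_gt0 a_lt5 {rho_x xE a_le1 a_le3} => [|[|[|[|[|]]]]] // _ _;
  by case: b b_lt6 => [|[|[|[|[|[|]]]]]].
Qed.

Lemma low_rho_odd n : odd n -> ~~ 3.-nat n -> (rho n <= 663 / 200)%R ->
  exists c q, n = 3 ^ c * q /\ q \in odd_cores.
Proof.
move=> odd_n n_npow3.
have [e [y [nE -> y_npow3 y_split]]] := rho_peel_pow3 (odd_gt0 odd_n) n_npow3.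
move=> rho_y; exists e, y; split=> //.
have odd_y : odd y by move: odd_n; rewrite nE oddM => /andP[].
case: y_split => [x v v_gt0 le_vx yE fyE|s t s_npow3 t_npow3 yE fyE]; last first.
  have /andP[odd_s odd_t] : odd s && odd t by rewrite -oddM -yE.
  have [rho_s rho_t] := (rho_odd_nonpow3 odd_s s_npow3, rho_odd_nonpow3 odd_t t_npow3).
  by have := rho_mul_ge yE fyE _ rho_s rho_t; lra.
rewrite {y nE}yE in fyE rho_y odd_y y_npow3 *; have x_gt0 := leq_trans v_gt0 le_vx.
have xv_le : 250 * (x * v) <= 373 * (x + v).
  by apply: rho_sum_bound x_gt0 _ fyE _ => //; lra.
have [x_le5|x_gt5] := leqP x 5; last first.
  have v1 : v = 1 by nia.
  by rewrite v1 in fyE odd_y y_npow3 rho_y *; exact: low_rho_odd_succ.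
have : x + v \in [:: 3; 5; 7; 9] by rewrite !inE; nia.
by rewrite !inE => /or4P[]/eqP y_val; rewrite y_val // in y_npow3 *.
Qed.

Lemma odd_cores_le163 q : q \in odd_cores -> q <= 163.
Proof. by apply/allP: q. Qed.

Lemma mid_rho_odd n : odd n -> ~~ 3.-nat n -> (rho n <= 283 / 50)%R ->
  exists c y, n = 3 ^ c * y /\
    (y <= 163 * 163 \/ exists a b, y = 2 ^ a * 3 ^ b + 1).
Proof.
move=> odd_n n_npow3.
have [e [y [nE -> y_npow3 y_split]]] := rho_peel_pow3 (odd_gt0 odd_n) n_npow3.
move=> rho_y; have odd_y : odd y by move: odd_n; rewrite nE oddM => /andP[].
case: y_split => [x v v_gt0 le_vx yE fyE|s t s_npow3 t_npow3 yE fyE]; last first.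
  have /andP[odd_s odd_t] : odd s && odd t by rewrite -oddM -yE.
  have [rho_s rho_t] := (rho_odd_nonpow3 odd_s s_npow3, rho_odd_nonpow3 odd_t t_npow3).
  rewrite (rho_mul yE fyE) in rho_y.
  have [|c [q [sE q_core]]] := low_rho_odd odd_s s_npow3; first by nra.
  have [|d [q' [tE q'_core]]] := low_rho_odd odd_t t_npow3; first by nra.
  exists (e + c + d), (q * q'); split; first by rewrite nE yE sE tE !expnD; ring.
  by left; rewrite leq_mul ?odd_cores_le163.
exists e, y; split=> //.
have [y_small|y_big] := leqP y (163 * 163); [by left|right].
rewrite {y nE odd_y y_npow3}yE in fyE rho_y y_big *; have x_gt0 := leq_trans v_gt0 le_vx.
have xv_le : 5 * (x * v) <= 9 * (x + v).
  by apply: rho_sum_bound x_gt0 _ fyE _ => //; lra.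
have v1 : v = 1 by nia.
rewrite {}v1 in fyE rho_y y_big *.
have x_big : 0 < 1000 <= x by lia.
have rho_x := rho_summand_le_nat x_big fyE; rewrite f_id // expr1 in rho_x.
have [|a [b [xE _]]] := low_rho_smooth x_gt0; first by lra.
by exists a, b; rewrite xE.
Qed.

(* The constant is below [(243 / 125) ^ 2], so that at most one factor is not 3-smooth. *)
Lemma rho_peel_smooth n : 0 < n -> ~~ smooth n -> (rho n <= 377 / 100)%R ->
  exists a b x v, [/\ n = 2 ^ a * 3 ^ b * (x + v), 0 < v <= x,
    f (x + v) = f x + f v, ~~ smooth (x + v) &
    rho n = ((9 / 8) ^+ a * rho (x + v))%R].
Proof.
move=> n_gt0 n_nsmooth rho_n.
have [m [y [m_smooth nE fnE y_nsmooth y_split]]] := peel_pnat n_gt0 n_nsmooth.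
have /andP[m_gt0 y_gt0] : (0 < m) && (0 < y) by rewrite -muln_gt0 -nE.
have rho_y := rho_nonsmooth y_gt0 y_nsmooth.
have [a [b [mE rhoE]]] : exists a b, m = 2 ^ a * 3 ^ b /\ rho n = ((9 / 8) ^+ a * rho y)%R.
  case: (ltnP 1 m) => [m_gt1|m_le1]; last first.
    by exists 0, 0; have m1 : m = 1 by [lia]; rewrite nE m1 mul1n expr0 mul1r.
  have rhoE := rho_mul nE (fnE m_gt1); rewrite rhoE in rho_n.
  have [|a [b [mE fmE]]] := low_rho_smooth m_gt0; first by nra.
  by exists a, b; split=> //; rewrite rhoE {1}mE rho_smooth -?mE.
have exp_ge1 : (1 <= (9 / 8) ^+ a :> Qf)%R := leq_exp98 (leq0n a).
case: y_split => [x v v_gt0 le_vx yE fyE|s t s_nsmooth t_nsmooth yE fyE].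
  exists a, b, x, v; rewrite -yE -mE; split=> //; first by rewrite v_gt0.
have /andP[s_gt0 t_gt0] : (0 < s) && (0 < t) by rewrite -muln_gt0 -yE.
have [rho_s rho_t] := (rho_nonsmooth s_gt0 s_nsmooth, rho_nonsmooth t_gt0 t_nsmooth).
have rho_y_le : (rho y <= rho n)%R by rewrite rhoE ler_peMl // (le_trans ler01) ?rho_ge1.
by have := rho_mul_ge yE fyE _ rho_s rho_t; lra.
Qed.

Lemma low_rho_nonsmooth n : 0 < n -> ~~ smooth n -> (rho n <= 367 / 100)%R ->
  exists a b y, [/\ n = 2 ^ a * 3 ^ b * y, a <= 5 &
    y <= 88 \/ exists d c, y = 2 ^ d * 3 ^ c + 1 /\ a + d <= 1].
Proof.
move=> n_gt0 n_nsmooth rho_n.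
have [|a [b [x [v [nE /andP[v_gt0 le_vx] fyE y_nsmooth rhoE]]]]] :=
  rho_peel_smooth n_gt0 n_nsmooth; first by lra.
have x_gt0 := leq_trans v_gt0 le_vx.
have y_gt0 : 0 < x + v by rewrite addn_gt0 x_gt0.
have exp_ge1 : (1 <= (9 / 8) ^+ a :> Qf)%R := leq_exp98 (leq0n a).
have rho_y := rho_nonsmooth y_gt0 y_nsmooth; rewrite rhoE in rho_n.
exists a, b, (x + v); split=> //.
  by rewrite -ltnS; apply: (@ltn_exp98 _ 6 2%:R%R); [nra|lra].
have [y_le88|y_gt88] := leqP (x + v) 88; [by left|right].
have xv_le : 20 * (x * v) <= 31 * (x + v).
  by apply: rho_sum_bound x_gt0 _ fyE _ => //; nra.
have v1 : v = 1 by nia.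
rewrite {}v1 in fyE y_gt88 rho_y rho_n *.
have x_ge88 : 0 < 88 <= x by lia.
have rho_x := rho_summand_le_nat x_ge88 fyE; rewrite f_id // expr1 in rho_x.
have rho_ax : ((9 / 8) ^+ a * rho x < (9 / 8) ^+ 2)%R by nra.
have [|d [c [xE rho_xE _]]] := @low_rho_exp98 x 2 x_gt0 _ isT.
  by have := rho_ge1 x_gt0; nra.
exists d, c; rewrite -xE; split=> //.
by apply: (ltn_exp98 _ rho_ax); rewrite exprD rho_xE.
Qed.

(** * Complexity of 2^i 3^k *)

Lemma of_nat_expn m n : N.of_nat (m ^ n) = (N.of_nat m ^ N.of_nat n)%num.
Proof.
elim: n => [|n IHn] //.
by rewrite expnS Nat2N.inj_mul IHn Nat2N.inj_succ N.pow_succ_r'.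
Qed.

Lemma leq_exp2_3 b : 2 ^ b <= 3 ^ b.
Proof. by case: b => // b; rewrite leq_exp2r. Qed.

Lemma smooth_dvd_exp6 s m : smooth s -> s <= 2 ^ m -> s %| 6 ^ m.
Proof.
move=> /smoothP[a [b ->]] s_le; rewrite (expnMn 2 3) dvdn_mul // dvdn_exp2l //.
  by rewrite -(@leq_exp2l 2) // (leq_trans _ s_le) // leq_pmulr ?expn_gt0.
rewrite -(@leq_exp2l 2) // (leq_trans (leq_exp2_3 b)) // (leq_trans _ s_le) //.
by rewrite leq_pmull ?expn_gt0.
Qed.

(* Decides whether [2 ^ i = D * (D' * (s + l) + k) + 1] for some 3-smooth [s], which by
   its size is a divisor of [6 ^ i].  It is run on binary numbers. *)
Definition pow2_solvable (i D k D' l : N) : bool :=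
  let u := (2 ^ i - 1)%num in
  let z := (u / D - k)%num in
  [&& (u mod D =? 0)%num, (z mod D' =? 0)%num & (6 ^ i mod (z / D' - l) =? 0)%num].

Lemma pow2_solvable_true i D k D' l s : 0 < D -> 0 < D' -> smooth s ->
  2 ^ i = D * (D' * (s + l) + k) + 1 ->
  pow2_solvable (N.of_nat i) (N.of_nat D) (N.of_nat k) (N.of_nat D') (N.of_nat l).
Proof.
move=> D_gt0 D'_gt0 smooth_s powE; rewrite /pow2_solvable.
have of_nat_neq0 m : 0 < m -> N.of_nat m <> 0%num by case: m.
have -> : (2 ^ N.of_nat i - 1 = N.of_nat (D' * (s + l) + k) * N.of_nat D)%num.
  have := congr1 N.of_nat powE; rewrite of_nat_expn Nat2N.inj_add => ->.
  by rewrite N.add_sub Nat2N.inj_mul N.mul_comm.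
rewrite N.Div0.mod_mul N.div_mul; last exact: of_nat_neq0.
have -> : (N.of_nat (D' * (s + l) + k) - N.of_nat k = N.of_nat (s + l) * N.of_nat D')%num.
  by rewrite Nat2N.inj_add N.add_sub Nat2N.inj_mul N.mul_comm.
rewrite N.Div0.mod_mul N.div_mul; last exact: of_nat_neq0.
rewrite Nat2N.inj_add N.add_sub /=.
have s_le : s <= 2 ^ i.
  rewrite powE (leq_trans _ (leq_addr _ _)) // (leq_trans _ (leq_pmull _ D_gt0)) //.
  by rewrite (leq_trans _ (leq_addr _ _)) // (leq_trans _ (leq_pmull _ D'_gt0)) ?leq_addr.
have /dvdnP[q expE] := smooth_dvd_exp6 smooth_s s_le.
have := congr1 N.of_nat expE; rewrite of_nat_expn Nat2N.inj_mul => ->.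
by rewrite N.Div0.mod_mul.
Qed.

Lemma all_iota_at (P : pred nat) m n i : all P (iota m n) -> m <= i < m + n -> P i.
Proof. by move=> /allP all_P i_range; apply: all_P; rewrite mem_iota. Qed.

Lemma pow2_neq_mul_succ i e y s : 19 <= i < 40 -> e < 4 -> 0 < y <= 88 -> smooth s ->
  2 ^ i <> 3 ^ e * (y * s + 1) + 1.
Proof.
move=> i_range e_lt4 y_range smooth_s powE.
have [y_gt0 _] := andP y_range; have D_gt0 : 0 < 3 ^ e by rewrite expn_gt0.
have {}powE : 2 ^ i = 3 ^ e * (y * (s + 0) + 1) + 1 by rewrite addn0.
have := pow2_solvable_true D_gt0 y_gt0 smooth_s powE; rewrite of_nat_expn.
have unsolvable : all (fun i => all (fun e => all (fun y => ~~ pow2_solvable (N.of_nat i)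
    (3 ^ N.of_nat e) 1 (N.of_nat y) 0) (iota 1 88)) (iota 0 4)) (iota 19 21).
  by vm_compute.
apply/negP.
exact: (all_iota_at (all_iota_at (all_iota_at unsolvable i_range) e_lt4) y_range).
Qed.

Lemma pow2_neq_smooth_mul_succ i e a b s : 19 <= i < 40 -> e < 4 -> a < 2 -> smooth s ->
  2 ^ i <> 3 ^ e * (2 ^ a * 3 ^ b * (s + 1) + 1) + 1.
Proof.
move=> i_range e_lt4 a_lt2 smooth_s powE.
have [D_gt0 A_gt0] : 0 < 3 ^ e /\ 0 < 2 ^ a by rewrite !expn_gt0.
have b_lt40 : b < 40.
  have [_ i_lt40] := andP i_range; apply: leq_ltn_trans i_lt40.
  rewrite -(leq_exp2l b i (isT : 1 < 2)) powE (leq_trans (leq_exp2_3 b)) //.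
  rewrite (leq_trans _ (leq_addr _ _)) // (leq_trans _ (leq_pmull _ D_gt0)) //.
  rewrite (leq_trans _ (leq_addr _ _)) // -mulnA (leq_trans _ (leq_pmull _ A_gt0)) //.
  by rewrite leq_pmulr ?addn1.
have D'_gt0 : 0 < 2 ^ a * 3 ^ b by rewrite muln_gt0 A_gt0 expn_gt0.
have := pow2_solvable_true D_gt0 D'_gt0 smooth_s powE; rewrite Nat2N.inj_mul !of_nat_expn.
have unsolvable : all (fun i => all (fun e => all (fun a => all (fun b => ~~ pow2_solvable
    (N.of_nat i) (3 ^ N.of_nat e) 1 (2 ^ N.of_nat a * 3 ^ N.of_nat b) 1)
    (iota 0 40)) (iota 0 2)) (iota 0 4)) (iota 19 21).
  by vm_compute.
apply/negP.
exact: (all_iota_at (all_iota_at (all_iota_at (all_iota_at unsolvable i_range)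
  e_lt4) a_lt2) b_lt40).
Qed.

Lemma pow2_neq_add2 i e s : 19 <= i < 40 -> e < 4 -> smooth s ->
  2 ^ i <> 3 ^ e * (s + 2) + 1.
Proof.
move=> i_range e_lt4 smooth_s powE.
have D_gt0 : 0 < 3 ^ e by rewrite expn_gt0.
have {}powE : 2 ^ i = 3 ^ e * (1 * (s + 0) + 2) + 1 by rewrite addn0 mul1n.
have := pow2_solvable_true D_gt0 (ltn0Sn 0) smooth_s powE; rewrite of_nat_expn.
have unsolvable : all (fun i => all (fun e => ~~ pow2_solvable (N.of_nat i)
    (3 ^ N.of_nat e) 2 1 0) (iota 0 4)) (iota 19 21).
  by vm_compute.
apply/negP; exact: (all_iota_at (all_iota_at unsolvable i_range) e_lt4).
Qed.

Lemma pow2_neq_core_mul i e q s : 19 <= i < 40 -> e < 4 -> q \in odd_cores -> smooth s ->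
  2 ^ i <> 3 ^ e * (q * (s + 1)) + 1.
Proof.
move=> i_range e_lt4 q_core smooth_s powE.
have D_gt0 : 0 < 3 ^ e * q by rewrite muln_gt0 expn_gt0; case: q q_core {powE}.
have {}powE : 2 ^ i = 3 ^ e * q * (1 * (s + 0) + 1) + 1 by rewrite addn0 mul1n -mulnA.
have := pow2_solvable_true D_gt0 (ltn0Sn 0) smooth_s powE.
rewrite Nat2N.inj_mul of_nat_expn; apply/negP.
have unsolvable : all (fun i => all (fun e => all (fun q => ~~ pow2_solvable (N.of_nat i)
    (3 ^ N.of_nat e * N.of_nat q) 1 1 0) odd_cores) (iota 0 4)) (iota 19 21).
  by vm_compute.
by have /allP := all_iota_at (all_iota_at unsolvable i_range) e_lt4; apply.
Qed.

(* The order of 2 modulo 81 is 54. *)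
Lemma pow3_dvd_pred_pow2 i e y : 19 <= i < 40 -> 2 ^ i = 3 ^ e * y + 1 -> e < 4.
Proof.
move=> i_range powE; rewrite ltnNge; apply/negP => e_ge4.
have unsolvable : all (fun i => ~~ (2 ^ N.of_nat i mod 81 =? 1)%num) (iota 19 21).
  by vm_compute.
have /negP := all_iota_at unsolvable i_range; apply.
have powE81 : 2 ^ i = 1 + 3 ^ (e - 4) * y * 81.
  by rewrite powE addnC mulnAC -(expnD 3 (e - 4) 4) subnK.
have := congr1 N.of_nat powE81; rewrite of_nat_expn Nat2N.inj_add Nat2N.inj_mul => ->.
by rewrite N.Div0.mod_add.
Qed.

Lemma pow3_mod8 b : (3 ^ b %% 8 == 1) || (3 ^ b %% 8 == 3).
Proof. by elim: b => [|b IHb] //; rewrite expnS; move: (3 ^ b) IHb; lia. Qed.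

Lemma pow3_add1_ndvd16 c : ~~ (16 %| 3 ^ c + 1).
Proof. by move: (3 ^ c) (pow3_mod8 c); lia. Qed.

Lemma smooth_add2_ndvd16 a b : ~~ (16 %| 2 ^ a * 3 ^ b + 2).
Proof.
have := pow3_mod8 b; move: (3 ^ b) => p.
case: a => [|[|a]]; rewrite ?mul1n ?expn1; try lia.
by rewrite !expnS -!mulnA; move: (2 ^ a * p); lia.
Qed.

Lemma smooth_add3_ndvd16 d c : d < 2 -> ~~ (16 %| 2 ^ d * 3 ^ c + 3).
Proof.
have := pow3_mod8 c; move: (3 ^ c) => p.
by case: d => [|[|]] // p_mod8 _; rewrite ?mul1n ?expn1; lia.
Qed.

Lemma core_add1_ndvd16 q : q \in odd_cores -> ~~ (16 %| q + 1).
Proof. by apply/allP: q. Qed.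

Lemma pow2_le_smooth i k j : j <= i -> 2 ^ j <= 2 ^ i * 3 ^ k.
Proof.
by move=> le_ji; apply: (@leq_trans (2 ^ i)); rewrite ?leq_exp2l // leq_pmulr ?expn_gt0.
Qed.

Section NeighboursOfSmooth.

Variables i k : nat.
Hypothesis i_range : 19 <= i < 40.
Local Notation n := (2 ^ i * 3 ^ k).

Lemma dvdn16_smooth : 16 %| n.
Proof.
have [i_ge19 _] := andP i_range.
by rewrite dvdn_mulr // (@dvdn_exp2l 2 4) // (leq_trans _ i_ge19).
Qed.

Lemma smooth_gt90000 : 300 * 300 < n.
Proof.
have [i_ge19 _] := andP i_range.
apply: leq_trans (pow2_le_smooth k (_ : 9 + 9 <= i)); last exact: leq_trans i_ge19.
by rewrite expnD (@ltn_mul 300 300 (2 ^ 9) (2 ^ 9)).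
Qed.

Lemma pow3_dvd_pred_smooth e y : n = 3 ^ e * y + 1 -> e < 4 /\ (0 < k -> e = 0).
Proof.
move=> nE; have e0 : 0 < k -> e = 0.
  move=> k_gt0; apply/eqP; rewrite -leqn0 leqNgt; apply/negP => e_gt0.
  have : 3 %| 3 ^ e * y + 1 by rewrite -nE dvdn_mull // dvdn_exp.
  by rewrite dvdn_addr // dvdn_mulr // dvdn_exp.
split=> //; case: (posnP k) => [k0|/e0-> //].
by apply: (pow3_dvd_pred_pow2 i_range (y := y)); rewrite -nE k0 muln1.
Qed.

Lemma smooth_sub2_rho x : 0 < k -> n = x + 2 -> (367 / 100 < rho x)%R.
Proof.
move=> k_gt0 nE; rewrite ltNge; apply/negP => rho_x.
have n_big := smooth_gt90000; have n_dvd16 := dvdn16_smooth.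
have x_gt0 : 0 < x by lia.
have [/smoothP[a [b xE]]|x_nsmooth] := boolP (smooth x).
  by have := smooth_add2_ndvd16 a b; rewrite -xE -nE n_dvd16.
have [a [[|b] [y [xE a_le5 y_cases]]]] := low_rho_nonsmooth x_gt0 x_nsmooth rho_x;
  last first.
  have : 3 %| x by rewrite xE expnS dvdn_mulr // dvdn_mull // dvdn_mulr.
  have : 3 %| x + 2 by rewrite -nE dvdn_mull // dvdn_exp.
  by lia.
rewrite muln1 in xE; case: y_cases => [y_le88|[d [c [yE ad_le1]]]].
  have : x <= 2 ^ 5 * 88 by rewrite xE leq_mul // leq_exp2l.
  by lia.
move: n_dvd16; rewrite nE xE yE; have := pow3_mod8 c; move: (3 ^ c) => p.
by case: a d ad_le1 {xE yE a_le5} => [|[|a]] [|[|d]] // _; rewrite ?expn0 ?expn1; lia.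
Qed.

Lemma smooth_pred_succ_rho e x : 0 < x -> n = 3 ^ e * (x + 1) + 1 -> (367 / 100 < rho x)%R.
Proof.
move=> x_gt0 nE; have [e_lt4 e0] := pow3_dvd_pred_smooth nE.
have [k0|k_gt0] := posnP k; last first.
  by apply: smooth_sub2_rho => //; rewrite nE e0 // mul1n -addnA.
have {}nE : 2 ^ i = 3 ^ e * (x + 1) + 1 by rewrite -nE k0 muln1.
rewrite ltNge; apply/negP => rho_x.
have [x_smooth|x_nsmooth] := boolP (smooth x).
  by apply: (@pow2_neq_mul_succ i e 1 x) => //; rewrite mul1n.
have smooth_exp a b : smooth (2 ^ a * 3 ^ b) by apply/smoothP; exists a, b.
have [a [b [y [xE _ [y_le88|[d [c [yE ad_le1]]]]]]]] :=
  low_rho_nonsmooth x_gt0 x_nsmooth rho_x.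
  apply: (@pow2_neq_mul_succ i e y (2 ^ a * 3 ^ b)) => //; last by rewrite [y * _]mulnC -xE.
  by rewrite y_le88 andbT; move: x_gt0; rewrite xE muln_gt0 => /andP[].
apply: (@pow2_neq_smooth_mul_succ i e a b (2 ^ d * 3 ^ c)) => //; last by rewrite -yE -xE.
exact: leq_trans (leq_addr d a) ad_le1.
Qed.

Lemma smooth_pred_neq_add2 e d c : d < 2 -> n <> 3 ^ e * (2 ^ d * 3 ^ c + 2) + 1.
Proof.
move=> d_lt2 nE; have [e_lt4 e0] := pow3_dvd_pred_smooth nE.
have [k0|k_gt0] := posnP k.
  apply: (@pow2_neq_add2 i e (2 ^ d * 3 ^ c)) => //; last by rewrite -nE k0 muln1.
  by apply/smoothP; exists d, c.
have {}nE : n = 2 ^ d * 3 ^ c + 3 by rewrite nE e0 // mul1n -addnA.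
by have := smooth_add3_ndvd16 c d_lt2; rewrite -nE dvdn16_smooth.
Qed.

Lemma smooth_neq_core_mul_succ q a b : 0 < k -> q \in odd_cores ->
  n <> q * (2 ^ a * 3 ^ b + 1) + 1.
Proof.
move=> k_gt0 q_core nE; have n_dvd16 := dvdn16_smooth; have n_big := smooth_gt90000.
have n_dvd3 : 3 %| n by rewrite dvdn_mull // dvdn_exp.
have a_lt4 : a < 4.
  rewrite ltnNge; apply/negP => a_ge4; case/negP: (core_add1_ndvd16 q_core).
  move: n_dvd16; rewrite nE mulnDr muln1 -addnA dvdn_addr // dvdn_mull // dvdn_mulr //.
  exact: (@dvdn_exp2l 2 4).
case: b nE => [|b] nE.
  have : n <= 163 * (2 ^ 3 * 1 + 1) + 1.
    by rewrite nE leq_add2r leq_mul ?odd_cores_le163 // leq_add2r leq_mul // leq_exp2l.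
  by lia.
have q5 : q = 5.
  have : 3 %| q + 1.
    move: n_dvd3; rewrite nE mulnDr muln1 expnS [2 ^ a * _]mulnCA mulnCA -addnA.
    by rewrite dvdn_addr // dvdn_mulr.
  by move: q_core; rewrite !inE => /or4P[/eqP->|/eqP->|/eqP->|/or3P[]/eqP->].
rewrite {q q_core}q5 in nE.
have a1 : a = 1.
  move: n_dvd16; rewrite nE; have := pow3_mod8 b.+1; move: (3 ^ b.+1) => p.
  by case: a a_lt4 {nE} => [|[|[|[|]]]] // _; rewrite ?expn0 ?expn1; lia.
rewrite {a a_lt4}a1 expn1 expnS in nE.
case: b nE => [|b] nE; first by move: n_big; rewrite nE; lia.
have [k_le1|k_gt1] := leqP k 1; last first.
  have : 9 %| n by rewrite dvdn_mull // (@dvdn_exp2l 3 2).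
  by rewrite nE expnS; move: (3 ^ b); lia.
apply: (@pow2_neq_mul_succ i 0 5 (2 ^ 1 * 3 ^ b.+1)) => //.
  by apply/smoothP; exists 1, b.+1.
have k1 : k = 1 by lia.
by move: nE; rewrite k1 !expn1 mul1n; move: (2 ^ i) (3 ^ b.+1); lia.
Qed.

Lemma smooth_pred_neq_core_mul e q a b : q \in odd_cores ->
  n <> 3 ^ e * (q * (2 ^ a * 3 ^ b + 1)) + 1.
Proof.
move=> q_core nE; have [e_lt4 e0] := pow3_dvd_pred_smooth nE.
have [k0|k_gt0] := posnP k; last first.
  by apply: (@smooth_neq_core_mul_succ q a b) => //; rewrite nE e0 // mul1n.
apply: (@pow2_neq_core_mul i e q (2 ^ a * 3 ^ b)) => //; last by rewrite -nE k0 muln1.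
by apply/smoothP; exists a, b.
Qed.

Lemma smooth_pred_sum_rho e x v : n = 3 ^ e * (x + v) + 1 -> 3000 < x + v ->
  0 < v <= x -> f (x + v) = f x + f v -> (2197 / 200 < rho (x + v))%R.
Proof.
move=> nE xv_gt3000 /andP[v_gt0 le_vx] fE; rewrite ltNge; apply/negP => rho_le.
have x_gt0 := leq_trans v_gt0 le_vx.
have xv_le : 4 * (x * v) <= 9 * (x + v).
  by apply: rho_sum_bound x_gt0 _ fE _ => //; lra.
have v_le2 : v <= 2 by clear -xv_le xv_gt3000 le_vx v_gt0; nia.
have x_big : 0 < 2000 <= x by lia.
have := rho_summand_le_nat x_big fE; rewrite f_id ?v_gt0 ?(leq_trans v_le2) // => rho_x.
clear xv_gt3000 le_vx fE xv_le.
case: v v_gt0 v_le2 nE rho_le rho_x => [|[|[|]]] // _ _ nE rho_le rho_x.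
  by have := smooth_pred_succ_rho x_gt0 nE; lra.
have [||d [c [xE _ d_lt2]]] := @low_rho_exp98 x 2 x_gt0 => //; first by lra.
by apply: (@smooth_pred_neq_add2 e d c); rewrite -?xE.
Qed.

Lemma smooth_pred_core_product_lt e q z : n = 3 ^ e * (q * z) + 1 -> q \in odd_cores ->
  z <= 163 * 163 -> i < 30.
Proof.
move=> nE q_core z_le; rewrite ltnNge; apply/negP => i_ge30.
have [e_lt4 _] := pow3_dvd_pred_smooth nE.
have n_le : n <= 2 ^ 29 + 1.
  rewrite nE leq_add2r (_ : 29 = 5 + (8 + 16)) // !(expnD 2) leq_mul //.
    by apply: (@leq_trans (3 ^ 3)); rewrite // leq_exp2l.
  rewrite leq_mul // ?(leq_trans (odd_cores_le163 q_core)) //.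
  by apply: leq_trans z_le _; rewrite (expnD 2 8 8) leq_mul.
have := leq_trans (pow2_le_smooth k i_ge30) n_le; rewrite (expnS 2 29).
by have := @leq_exp2l 2 1 29 isT; move: (2 ^ 29) => P /=; lia.
Qed.

Lemma smooth_pred_product_rho e s t : n = 3 ^ e * (s * t) + 1 -> odd s -> odd t ->
  ~~ 3.-nat s -> ~~ 3.-nat t -> 30 <= i -> (2197 / 200 < rho s * rho t)%R.
Proof.
move=> nE odd_s odd_t s_npow3 t_npow3 i_ge30; rewrite ltNge; apply/negP => rho_st.
have [rho_s rho_t] := (rho_odd_nonpow3 odd_s s_npow3, rho_odd_nonpow3 odd_t t_npow3).
wlog rho_s_le : s t nE odd_s odd_t s_npow3 t_npow3 rho_st rho_s rho_t /
    (rho s <= 663 / 200)%R => [wl|].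
  have [|rho_s_gt] := leP (rho s) (663 / 200)%R; first exact: (wl s t).
  apply: (wl t s) => //; rewrite 1?[t * s]mulnC // 1?mulrC //.
  by clear -rho_s_gt rho_st rho_t; nra.
have [c [q [sE q_core]]] := low_rho_odd odd_s s_npow3 rho_s_le.
have rho_t_le : (rho t <= 283 / 50)%R by clear -rho_s rho_st rho_t; nra.
have [d [z [tE z_cases]]] := mid_rho_odd odd_t t_npow3 rho_t_le.
have {}nE : n = 3 ^ (e + c + d) * (q * z) + 1 by rewrite nE sE tE !expnD; ring.
case: z_cases => [z_le|[a [b zE]]].
  by have := smooth_pred_core_product_lt nE q_core z_le; rewrite ltnNge i_ge30.
by apply: (@smooth_pred_neq_core_mul (e + c + d) q a b) => //; rewrite -zE.
Qed.

(* Below [2 ^ 30] the weaker bound suffices, and the product of two classified odd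
   factors is not excluded. *)
Lemma smooth_pred_rho u : n = u + 1 ->
  ((if (i < 30)%N then 377 / 100 else 2197 / 200) < rho u)%R.
Proof.
move=> nE; have n_big := smooth_gt90000; have n_dvd16 := dvdn16_smooth.
have odd_u : odd u by move: n_dvd16; rewrite nE; lia.
have u_npow3 : ~~ 3.-nat u.
  apply/negP => /p_natP[c uE]; have := pow3_add1_ndvd16 c.
  by rewrite -uE -nE n_dvd16.
have [e [y [uE -> y_npow3 y_split]]] := rho_peel_pow3 (odd_gt0 odd_u) u_npow3.
rewrite uE in nE; have [e_lt4 _] := pow3_dvd_pred_smooth nE.
case: y_split => [x v v_gt0 le_vx yE fyE|s t s_npow3 t_npow3 yE fyE].
  have y_gt3000 : 3000 < y.
    have : 3 ^ e <= 27 by rewrite (@leq_exp2l 3 e 3).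
    by move: n_big; rewrite nE; move: (3 ^ e); clear; nia.
  rewrite {y uE y_npow3}yE in nE fyE y_gt3000 *.
  have := smooth_pred_sum_rho nE y_gt3000; rewrite v_gt0 => /(_ le_vx fyE).
  by case: ifP; lra.
have /andP[odd_s odd_t] : odd s && odd t.
  by rewrite -oddM -yE; move: odd_u; rewrite uE oddM => /andP[].
have [rho_s rho_t] := (rho_odd_nonpow3 odd_s s_npow3, rho_odd_nonpow3 odd_t t_npow3).
case: ltnP => [_|i_ge30]; first by have := rho_mul_ge yE fyE _ rho_s rho_t; lra.
by rewrite (rho_mul yE fyE); apply: (smooth_pred_product_rho (e := e)); rewrite // -yE.
Qed.

End NeighboursOfSmooth.

Section DeficientSum.

Variables i k x v : nat.
Hypothesis i_lt40 : i < 40.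
Hypothesis nE : 2 ^ i * 3 ^ k = x + v.
Hypothesis v_gt0 : 0 < v.
Hypothesis le_vx : v <= x.
Hypothesis fE : f (x + v) = f x + f v.
Hypothesis f_lt : f (2 ^ i * 3 ^ k) < 2 * i + 3 * k.

Lemma deficient_i_ge10 : 10 <= i.
Proof.
rewrite leqNgt; apply/negP => i_lt10; move: (f_lt); rewrite f_smooth_lt10 ?ltnn //.
by rewrite lt0n; apply: contraTneq f_lt => ik0; lia.
Qed.

Lemma deficient_sum_rho_le : (rho (x + v) * 3%:R <= (9 / 8) ^+ i)%R.
Proof. by rewrite -nE rho_smooth_of_lt. Qed.

Lemma deficient_sum_gt1000 : 1000 < x + v.
Proof.
apply: (@leq_trans (2 ^ 10)); first by lia.
by rewrite -nE pow2_le_smooth ?deficient_i_ge10.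
Qed.

Lemma deficient_v_le3 : v <= 3.
Proof.
have n_gt1000 := deficient_sum_gt1000; have x_gt0 := leq_trans v_gt0 le_vx.
have xv_le : 100 * (x * v) <= 321 * (x + v).
  apply: rho_sum_bound x_gt0 _ fE _ => //.
  by have := deficient_sum_rho_le; have := leq_exp98 (i_lt40 : i <= 39); lra.
have v_le6 : v <= 6 by nia.
move: xv_le n_gt1000; case: v v_le6 => [|[|[|[|[|[|[|]]]]]]] // _; lia.
Qed.

Lemma deficient_summand_rho_le q : 0 < q <= x ->
  (rho x * 3%:R ^+ v * 3%:R <= (9 / 8) ^+ i * ((q + v)%:R / q%:R) ^+ 3)%R.
Proof.
move=> q_range; have := rho_summand_le_nat q_range fE; rewrite f_id; last first.
  by rewrite v_gt0 (leq_trans deficient_v_le3).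
have ratio_ge0 : (0 <= ((q + v)%:R / q%:R) ^+ 3 :> Qf)%R.
  by rewrite exprn_ge0 ?divr_ge0 ?ler0n.
have := ler_wpM2r ratio_ge0 deficient_sum_rho_le.
by move: (_ ^+ 3)%R (_ ^+ v)%R (_ ^+ i)%R => *; lra.
Qed.

Lemma deficient_i_ge19 : 19 <= i.
Proof.
rewrite leqNgt; apply/negP => i_lt19; have exp_le := leq_exp98 (i_lt19 : i <= 18).
have n_gt1000 := deficient_sum_gt1000; have x_gt0 := leq_trans v_gt0 le_vx.
have x_ge300 : 0 < 300 <= x by lia.
have := deficient_summand_rho_le x_ge300; have := rho_ge1 x_gt0.
case: v v_gt0 deficient_v_le3 => [|[|[|[|]]]] // _ _; lra.
Qed.

Lemma deficient_sum_absurd : False.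
Proof.
have i_range : 19 <= i < 40 by rewrite deficient_i_ge19.
have x_big : 0 < 120 * 120 <= x by have := smooth_gt90000 k i_range; rewrite nE; lia.
have := deficient_summand_rho_le x_big; rewrite natrD natrM.
have exp_le := leq_exp98 (i_lt40 : i <= 39).
case: v v_gt0 deficient_v_le3 nE => [|[|[|[|]]]] // _ _ xE rho_x.
- have := smooth_pred_rho i_range xE; case: ltnP => [i_lt30|_]; last by lra.
  by have := leq_exp98 (i_lt30 : i <= 29); lra.
- have x_gt0 : 0 < x by case/andP: x_big => /leq_trans; apply.
  have := @smooth_pred_succ_rho i k i_range 0 x x_gt0.
  by rewrite mul1n -addnA xE => /(_ erefl); lra.
have x_gt0 : 0 < x by case/andP: x_big => /leq_trans; apply.
have [|//|d [c [xE' _ d_lt2]]] := @low_rho_exp98 x 2 x_gt0; first by lra.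
by have := smooth_add3_ndvd16 c d_lt2; rewrite -xE' -xE dvdn16_smooth.
Qed.

End DeficientSum.

Lemma smooth_inj a b c d : 2 ^ a * 3 ^ b = 2 ^ c * 3 ^ d -> a = c /\ b = d.
Proof.
move=> eq_smooth.
move: (congr1 (logn 2) eq_smooth) (congr1 (logn 3) eq_smooth).
by rewrite !lognM ?expn_gt0 // !lognX !logn_prime //= !muln0 !muln1 !addn0.
Qed.

Lemma smooth_mulP i k s t : 2 ^ i * 3 ^ k = s * t -> exists a b c d,
  [/\ s = 2 ^ a * 3 ^ b, t = 2 ^ c * 3 ^ d, i = a + c & k = b + d].
Proof.
move=> stE; have : smooth (s * t) by apply/smoothP; exists i, k.
rewrite pnatM => /andP[/smoothP[a [b sE]] /smoothP[c [d tE]]].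
exists a, b, c, d; have [|-> ->] // := @smooth_inj i k (a + c) (b + d).
by rewrite stE sE tE !expnD mulnACA.
Qed.

Lemma f_smooth_ge i k : i < 40 -> 2 * i + 3 * k <= f (2 ^ i * 3 ^ k).
Proof.
move: {2}(2 ^ i * 3 ^ k) (erefl (2 ^ i * 3 ^ k)) => n.
elim/ltn_ind: n i k => n IHn i k nE i_lt40.
have [n_le1|n_gt1] := leqP n 1.
  have [|-> ->] // := @smooth_inj i k 0 0.
  by apply/eqP; rewrite nE eqn_leq n_le1 -nE muln_gt0 !expn_gt0.
case: (f_optimal_split n_gt1) => [x v v_gt0 le_vx xvE fE|s t s_gt1 t_gt1 stE fE].
  rewrite leqNgt; apply/negP; rewrite xvE in nE fE.
  exact: deficient_sum_absurd i_lt40 nE v_gt0 le_vx fE.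
have [a [b [c [d [sE tE iE kE]]]]] := smooth_mulP (etrans nE stE).
have [s_lt t_lt] : s < n /\ t < n by rewrite stE ltn_Pmulr ?ltn_Pmull // ltnW.
have fs_ge := IHn s s_lt a b (esym sE); have ft_ge := IHn t t_lt c d (esym tE).
by rewrite nE fE iE kE sE tE; lia.
Qed.

Lemma f_smooth i k : 0 < i + k -> i < 40 -> f (2 ^ i * 3 ^ k) = 2 * i + 3 * k.
Proof. by move=> ik_gt0 i_lt40; apply/eqP; rewrite eqn_leq f_smooth_le ?f_smooth_ge. Qed.

(** * Sums of few powers *)

Section SparseSums.

Variable p : nat.
Hypothesis p_gt1 : 1 < p.

Definition powsum (s : seq nat) : nat := \sum_(a <- s) p ^ a.

Definition sparse (D n : nat) : Prop := exists2 s, size s <= D & n = powsum s.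

Lemma expp_gt0 a : 0 < p ^ a.
Proof. by rewrite expn_gt0 ltnW. Qed.

Lemma powsum_nseq0 n : powsum (nseq n 0) = n.
Proof. by rewrite /powsum big_nseq iter_addn addn0 mul1n. Qed.

Lemma powsum_mul s t : powsum s * powsum t = powsum [seq a + b | a <- s, b <- t].
Proof.
rewrite /powsum big_allpairs_dep big_distrlr; apply: eq_bigr => a _.
by apply: eq_bigr => b _; rewrite expnD.
Qed.

Lemma sparse_leq D D' n : D <= D' -> sparse D n -> sparse D' n.
Proof. by move=> le_DD' [s s_size nE]; exists s; rewrite ?(leq_trans s_size). Qed.

Lemma sparse_id n : sparse n n.
Proof. by exists (nseq n 0); rewrite ?powsum_nseq0 ?size_nseq. Qed.

Lemma sparse_exp e : sparse 1 (p ^ e).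
Proof. by exists [:: e]; rewrite // /powsum big_seq1. Qed.

Lemma sparse_add D D' m n : sparse D m -> sparse D' n -> sparse (D + D') (m + n).
Proof.
move=> [s s_size ->] [t t_size ->]; exists (s ++ t); first by rewrite size_cat leq_add.
by rewrite /powsum big_cat.
Qed.

Lemma sparse_mul D D' m n : sparse D m -> sparse D' n -> sparse (D * D') (m * n).
Proof.
move=> [s s_size ->] [t t_size ->]; exists [seq a + b | a <- s, b <- t].
  by rewrite size_allpairs leq_mul.
exact: powsum_mul.
Qed.

Lemma lowsum_succ s t : \sum_(x <- s | x < t.+1) p ^ x =
  \sum_(x <- s | x < t) p ^ x + count_mem t s * p ^ t.
Proof.
elim: s => [|x s IHs]; first by rewrite !big_nil.
rewrite !big_cons /= ltnS; case: ltngtP => [_|_|->] /=; rewrite IHs.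
- by rewrite addnA.
- by [].
by rewrite mulnDl mul1n addnCA.
Qed.

Lemma count_lt_succ (s : seq nat) t :
  count (fun x => x < t.+1) s = count (fun x => x < t) s + count_mem t s.
Proof.
elim: s => [|x s IHs] //=; rewrite IHs ltnS addnACA; congr (_ + _).
by case: ltngtP.
Qed.

Lemma lowsum_le_count (s : seq nat) t :
  \sum_(x <- s | x < t) p ^ x <= count (fun x => x < t) s * p ^ t.
Proof.
elim: s => [|x s IHs]; first by rewrite big_nil.
rewrite big_cons /=; case: ltnP => // lt_xt; rewrite mulnDl mul1n leq_add //.
by rewrite leq_exp2l // ltnW.
Qed.

Lemma powsum_modn s t : powsum s = \sum_(x <- s | x < t) p ^ x %[mod p ^ t].
Proof.
rewrite /powsum (bigID (fun x => x < t)) /=; apply/eqP.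
rewrite -[X in _ == X %[mod _]]addn0 eqn_modDl mod0n.
by apply/dvdn_sum => x; rewrite -leqNgt; exact: dvdn_exp2l.
Qed.

Lemma exp_le_bigsum (s : seq nat) (P : pred nat) a : a \in s -> P a ->
  p ^ a <= \sum_(x <- s | P x) p ^ x.
Proof. by move=> a_s Pa; rewrite (big_rem a) //= Pa leq_addr. Qed.

(* A carry that starts at position [a] must be fed at every position up to [m], and
   each feeding uses up terms of the sum. *)
Lemma powsum_gap s A m B a : powsum s = A * p ^ m + B -> a \in s -> B < p ^ a ->
  m <= a + size s.
Proof.
move=> sE a_s B_lt; have [/leq_trans->|lt_am] // := leqP m a; first by rewrite leq_addr.
have carry t : a < t <= m -> p ^ t <= \sum_(x <- s | x < t) p ^ x.
  case/andP=> lt_at le_tm; rewrite leqNgt; apply/negP => low_lt.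
  have B_lt_t : B < p ^ t by apply: leq_trans B_lt _; rewrite leq_exp2l // ltnW.
  have := powsum_modn s t; rewrite sE -(subnK le_tm) expnD mulnA modnMDl !modn_small //.
  by move=> BE; move: B_lt; rewrite BE ltnNge (exp_le_bigsum a_s lt_at).
have fed d : a + d <= m -> d * p ^ (a + d) + \sum_(x <- s | x < a + d) p ^ x <=
    count (fun x => x < a + d) s * p ^ (a + d).
  elim: d => [|d IHd] le_dm; first by rewrite addn0 lowsum_le_count.
  have {}IHd := IHd (leq_trans (leq_add (leqnn _) (leqnSn d)) le_dm).
  rewrite addnS in le_dm *.
  have := carry (a + d).+1; rewrite le_dm andbT ltnS leq_addr => /(_ isT).
  rewrite lowsum_succ count_lt_succ expnS; move: IHd.
  move: (\sum_(_ <- _ | _) _) (count _ s) (count _ s) (p ^ _) p_gt1.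
  by clear; nia.
have := fed (m - a); rewrite subnKC ?(ltnW lt_am) // => /(_ (leqnn _)) fed_m.
have : (m - a) * p ^ m <= size s * p ^ m.
  apply: leq_trans (leq_trans (leq_addr _ _) fed_m) _.
  by rewrite leq_mul2r count_size orbT.
by rewrite leq_pmul2r ?expp_gt0 //; lia.
Qed.

Lemma powsum_split s g B : (forall b, b \in s -> p ^ b <= B \/ g <= b) ->
  exists A' B', powsum s = A' * p ^ g + B' /\ B' <= size s * B.
Proof.
elim: s => [|x s IHs] s_cases; first by exists 0, 0; rewrite /powsum big_nil.
have [|A' [B' [sE B'_le]]] := IHs.
  by move=> b b_s; apply: s_cases; rewrite inE b_s orbT.
rewrite /powsum big_cons -/(powsum s) sE /= mulSn.
have [x_le|x_ge] := s_cases x (mem_head _ _).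
  by exists A', (p ^ x + B'); rewrite addnCA leq_add.
exists (p ^ (x - g) + A'), B'; rewrite mulnDl -expnD subnK // addnA; split=> //.
exact: leq_trans B'_le (leq_addl _ _).
Qed.

Lemma powsum_le s B : {in s, forall a, p ^ a <= B} -> powsum s <= size s * B.
Proof.
move=> s_le; rewrite -sum1_size big_distrl /powsum !big_seq.
by apply: leq_sum => a a_s; rewrite /= mul1n s_le.
Qed.

Lemma powsum_mul_gap s t A m B a b : powsum s * powsum t = A * p ^ m + B ->
  a \in s -> b \in t -> B < p ^ (a + b) -> m <= a + b + size s * size t.
Proof.
move=> stE a_s b_t B_lt; rewrite powsum_mul in stE.
by have := powsum_gap stE (allpairs_f addn a_s b_t) B_lt; rewrite size_allpairs.
Qed.

Lemma powsum_mul_low_pair s t A m B : powsum s * powsum t = A * p ^ m + B -> 0 < B ->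
  B + size s * size t <= m -> exists a b : nat, [/\ a \in s, b \in t & p ^ (a + b) <= B].
Proof.
move=> stE B_gt0 m_big.
have [/hasP[a a_s /hasP[b b_t ab_le]]|no_low] :=
  boolP (has (fun a => has (fun b => p ^ (a + b) <= B) t) s); first by exists a, b.
have : p ^ (m - size s * size t) %| B.
  rewrite -(dvdn_addr B (_ : _ %| A * p ^ m)) -?stE; last first.
    by rewrite dvdn_mull // dvdn_exp2l // leq_subr.
  rewrite powsum_mul /powsum big_seq.
  apply: dvdn_sum => _ /allpairsP[[a b] /= [a_s b_t ->]].
  apply: dvdn_exp2l; rewrite leq_subLR addnC.
  apply: (powsum_mul_gap stE a_s b_t); rewrite ltnNge; apply: contra no_low => ab_le.
  by apply/hasP; exists a => //=; apply/hasP; exists b.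
move/(dvdn_leq B_gt0)/(leq_trans (ltn_expl _ p_gt1)).
by lia.
Qed.

(* If both factors had a large term, multiplying it by the other half of a low pair
   would put both large terms near [p ^ m], and their product beyond [A * p ^ m + B]. *)
Lemma powsum_mul_low_factor s t A m B : powsum s * powsum t = A * p ^ m + B -> 0 < B ->
  A + 2 * B + 2 * (size s * size t) <= m ->
  all (fun a => p ^ a <= B) s || all (fun b => p ^ b <= B) t.
Proof.
move=> stE B_gt0 m_big; apply: contraT; rewrite negb_or -!has_predC.
case/andP=> /hasP[a a_s /= a_big] /hasP[b b_t /= b_big]; rewrite -!ltnNge in a_big b_big.
have [|a' [b' [a'_s b'_t ab'_le]]] := powsum_mul_low_pair stE B_gt0; first by lia.
have m_le : m <= a + b' + size s * size t.
  by apply: powsum_mul_gap stE a_s b'_t (leq_trans a_big _); rewrite leq_exp2l ?leq_addr.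
have m_le' : m <= a' + b + size s * size t.
  by apply: powsum_mul_gap stE a'_s b_t (leq_trans b_big _); rewrite leq_exp2l ?leq_addl.
have ab'_lt : a' + b' < B by apply: leq_trans ab'_le; exact: ltn_expl.
have ab_lt : a + b < A + B + m.
  rewrite -(ltn_exp2l _ _ p_gt1) [p ^ (a + b)]expnD.
  apply: leq_ltn_trans (leq_mul (exp_le_bigsum (P := xpredT) a_s isT)
    (exp_le_bigsum (P := xpredT) b_t isT)) _.
  rewrite -!/(powsum _) stE; apply: (@leq_ltn_trans ((A + B) * p ^ m)).
    by rewrite mulnDl leq_add2l leq_pmulr ?expp_gt0.
  by rewrite expnD ltn_pmul2r ?expp_gt0 // ltn_expl.
by lia.
Qed.

Lemma powsum_mul_split s t A m B G : powsum s * powsum t = A * p ^ m + B -> 0 < B ->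
  {in s, forall a, p ^ a <= B} -> B + size s * size t <= G ->
  G + size s * B * (size t * B) + B < m ->
  exists A' B', [/\ powsum t = A' * p ^ (m - G) + B', powsum s * B' = B &
    powsum s * A' = A * p ^ G].
Proof.
move=> stE B_gt0 s_low G_big m_big.
have [a a_s] : exists a, a \in s.
  case: s stE {s_low G_big m_big} => [|a s _]; last by exists a; rewrite mem_head.
  by rewrite /powsum big_nil mul0n; lia.
have [|A' [B' [tE B'_le]]] := @powsum_split t (m - G) B.
  move=> b b_t; have [b_le|b_gt] := leqP (p ^ b) B; [by left|right].
  have B_lt : B < p ^ (a + b) by apply: leq_trans b_gt _; rewrite leq_exp2l // leq_addl.
  have := powsum_mul_gap stE a_s b_t B_lt.
  by have := leq_trans (ltn_expl a p_gt1) (s_low a a_s); lia.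
exists A', B'; have B_lt : B + size s * B * (size t * B) < p ^ (m - G).
  by apply: leq_trans (ltn_expl _ p_gt1); lia.
have sB'_le : powsum s * B' <= size s * B * (size t * B) by rewrite leq_mul ?powsum_le.
have : powsum s * A' * p ^ (m - G) + powsum s * B' = A * p ^ G * p ^ (m - G) + B.
  by rewrite -mulnA -mulnDr -tE stE -[A * p ^ G * _]mulnA -expnD subnKC //; lia.
move/(congr1 (edivn^~ (p ^ (m - G)))); rewrite !edivn_eq; [|by lia|by lia].
by move=> [sA'E sB'E]; split.
Qed.

Lemma sparse_factor D A B : 0 < B -> exists M G C, forall m U W, M <= m ->
  sparse D U -> sparse D W -> U * W = A * p ^ m + B ->
  exists u w A' B', [/\ (u, w) = (U, W) \/ (u, w) = (W, U), u <= C,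
    w = A' * p ^ (m - G) + B', u * B' = B & u * A' = A * p ^ G].
Proof.
move=> B_gt0; pose G := B + D * D; pose C := D * B.
exists (G + C * C + B + A + 2 * B + 2 * (D * D)).+1, G, C.
move=> m _ _ m_big [s s_size ->] [t t_size ->] stE.
have oriented s' t' : size s' <= D -> size t' <= D ->
    powsum s' * powsum t' = A * p ^ m + B -> all (fun a => p ^ a <= B) s' ->
    exists A' B', [/\ powsum s' <= C, powsum t' = A' * p ^ (m - G) + B',
      powsum s' * B' = B & powsum s' * A' = A * p ^ G].
  move=> s'_size t'_size stE' /allP s'_low.
  have [||A' [B' [tE sB'E sA'E]]] := powsum_mul_split (G := G) stE' B_gt0 s'_low.
  - by rewrite leq_add2l leq_mul.
  - have : size s' * B * (size t' * B) <= C * C by rewrite !leq_mul.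
    by lia.
  exists A', B'; split=> //; apply: leq_trans (powsum_le s'_low) _.
  by rewrite leq_mul2r s'_size orbT.
have st_le : size s * size t <= D * D by exact: leq_mul.
have /orP[s_low|t_low] : all (fun a => p ^ a <= B) s || all (fun b => p ^ b <= B) t.
- by apply: powsum_mul_low_factor stE B_gt0 _; lia.
- have [A' [B' [sC tE sB'E sA'E]]] := oriented s t s_size t_size stE s_low.
  by exists (powsum s), (powsum t), A', B'; split=> //; left.
rewrite mulnC in stE.
have [A' [B' [tC sE tB'E tA'E]]] := oriented t s t_size s_size stE t_low.
by exists (powsum t), (powsum s), A', B'; split=> //; right.
Qed.

End SparseSums.

(** * Complexity of A 3^m + B *)

Lemma optimal_summand_le x v r : 0 < v <= x -> f (x + v) = f x + f v ->
  (rho (x + v) <= r%:R)%R -> v <= 2 * r.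
Proof.
case/andP=> v_gt0 le_vx fE rho_le; have x_gt0 := leq_trans v_gt0 le_vx.
have r_ge1 : (1 <= r%:R :> Qf)%R.
  by apply: le_trans (rho_ge1 _) rho_le; rewrite addn_gt0 x_gt0.
have xv_le : 1 * (x * v) <= r * (x + v).
  apply: (rho_sum_bound x_gt0 _ fE) => //; apply: le_trans rho_le _.
  by rewrite divr1 ler_eXnr.
rewrite -(leq_pmul2l x_gt0) -[x * v]mul1n (leq_trans xv_le) //.
by rewrite [x * _]mulnC -mulnA mulnCA leq_mul2l mul2n -addnn leq_add2l le_vx orbT.
Qed.

Lemma rho_summand_le8 x v : 0 < v <= x -> f (x + v) = f x + f v ->
  (rho x <= rho (x + v) * 8)%R.
Proof.
case/andP=> v_gt0 le_vx fE; have x_gt0 := leq_trans v_gt0 le_vx.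
have := @rho_summand_le x v 2%:R%R x_gt0 fE.
rewrite -natrM ler_nat mul2n -addnn leq_add2l => /(_ le_vx).
have : (rho x <= rho x * 3%:R ^+ f v)%R.
  by rewrite ler_peMr ?exprn_ege1 ?ler1n // (le_trans ler01) ?rho_ge1.
by lra.
Qed.

(* The factor [3 ^ f v >= 3] exceeds [(5/4) ^ 3] by more than a factor [9/8]. *)
Lemma rho_summand_drop x v : 0 < v -> 4 * v <= x -> f (x + v) = f x + f v ->
  (9 / 8 * rho x <= rho (x + v))%R.
Proof.
move=> v_gt0 le_vx fE; have x_gt0 : 0 < x by lia.
have ratio_le : ((x + v)%:R <= 5 / 4 * x%:R :> Qf)%R.
  by rewrite mulrAC ler_pdivlMr // -!natrM ler_nat; lia.
have fv_ge : (3%:R <= 3%:R ^+ f v :> Qf)%R.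
  by rewrite -[leLHS]expr1 ler_eXn2l ?f_gt0 ?ltr1n.
have := rho_summand_le x_gt0 fE ratio_le; have := rho_ge1 x_gt0.
have : (rho x * 3%:R <= rho x * 3%:R ^+ f v)%R.
  by rewrite ler_wpM2l // (le_trans ler01) ?rho_ge1.
by lra.
Qed.

Lemma leq_exp98_exp2 K : ((9 / 8) ^+ K <= (2 ^ K)%:R :> Qf)%R.
Proof. by rewrite natrX lerXn2r ?nnegrE //; lra. Qed.

Lemma rho_le_exp98_sparse K : exists D, forall n, 0 < n -> (rho n <= (9 / 8) ^+ K)%R ->
  sparse 3 D n.
Proof.
elim: K => [|K [D IHD]].
  exists 1 => n n_gt0; rewrite expr0 => rho_n.
  have [/p_natP[c ->]|n_npow3] := boolP (3.-nat n); first exact: sparse_exp.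
  by have := rho_nonpow3 n_gt0 n_npow3; lra.
pose V := 2 * 2 ^ K.+1; exists (1 + D * D + (D + V) + 5 * V) => n n_gt0 rho_n.
have [/p_natP[c ->]|n_npow3] := boolP (3.-nat n).
  by apply: sparse_leq (sparse_exp 3 c); lia.
have [e [y [nE rhoE y_npow3 y_split]]] := rho_peel_pow3 n_gt0 n_npow3.
rewrite rhoE exprS in rho_n.
have exp_gt0 : (0 < (9 / 8) ^+ K :> Qf)%R by rewrite exprn_gt0 ?(lt_trans ltr01) ?lt1_98.
suff [D' le_D' y_sparse] : exists2 D', D' <= D * D + (D + V) + 5 * V & sparse 3 D' y.
  rewrite nE; apply: sparse_leq (sparse_mul (sparse_exp 3 e) y_sparse).
  by lia.
case: y_split => [x v v_gt0 le_vx yE fyE|s t s_npow3 t_npow3 yE fyE]; last first.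
  have /andP[y_gt0] : (0 < 3 ^ e) && (0 < y) by rewrite -muln_gt0 -nE.
  rewrite yE muln_gt0 => /andP[s_gt0 t_gt0].
  have [rho_s rho_t] := (rho_nonpow3 s_gt0 s_npow3, rho_nonpow3 t_gt0 t_npow3).
  rewrite (rho_mul yE fyE) in rho_n; exists (D * D); first by lia.
  by apply: sparse_mul; apply: IHD => //; clear -exp_gt0 rho_s rho_t rho_n; nra.
rewrite {y y_npow3 nE rhoE}yE in fyE rho_n *; have x_gt0 := leq_trans v_gt0 le_vx.
have v_le : v <= V.
  apply: optimal_summand_le fyE _; first by rewrite v_gt0.
  by apply: le_trans rho_n _; rewrite -exprS leq_exp98_exp2.
have [x_ge|x_lt] := leqP (4 * V) x; last first.
  by exists (x + v); [lia|exact: sparse_id].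
exists (D + V); first by lia.
apply: sparse_add; last exact: (sparse_leq v_le (sparse_id 3 v)).
have le_4vx : 4 * v <= x by lia.
by apply: IHD => //; have := rho_summand_drop v_gt0 le_4vx fyE; lra.
Qed.

Lemma rho_le_sparse (r : nat) : exists D, forall n, 0 < n -> (rho n <= r%:R)%R ->
  sparse 3 D n.
Proof.
have [D D_sparse] := rho_le_exp98_sparse (6 * r); exists D => n n_gt0 rho_n.
apply: D_sparse => //; apply: le_trans rho_n _; rewrite exprM.
apply: (@le_trans _ _ (2%:R ^+ r)%R); first by rewrite -natrX ler_nat ltnW // ltn_expl.
by rewrite lerXn2r ?nnegrE ?exprn_ge0 //; lra.
Qed.

Definition eventually (P : nat -> Prop) : Prop := exists M, forall m, M <= m -> P m.

Lemma eventually_forall_le (P : nat -> nat -> Prop) C :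
  (forall u, eventually (P u)) -> eventually (fun m => forall u, u <= C -> P u m).
Proof.
move=> P_ev; elim: C => [|C [M P_M]].
  by have [M P0] := P_ev 0; exists M => m le_Mm u; rewrite leqn0 => /eqP->; exact: P0.
have [N P_N] := P_ev C.+1; exists (M + N) => m le_MNm u.
rewrite leq_eqVlt ltnS => /orP[/eqP->|le_uC]; first by apply: P_N; lia.
by apply: P_M => //; lia.
Qed.

(* For positive [A] the sequence [f (A * 3 ^ k) - 3 * k] does not increase, so it
   stabilises, at a value that is at least [c]. *)
Definition stable_f_ge (A : nat) (c : int) : Prop :=
  forall k, (c + (3 * k)%:Z <= (f (A * 3 ^ k))%:Z)%R.

Definition offset_f_ge (A B : nat) (c : int) : Prop :=
  eventually (fun m => (c + (3 * m)%:Z <= (f (A * 3 ^ m + B))%:Z)%R).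

Section OffsetStep.

Variables (A B : nat) (c : int).
Hypothesis A_gt0 : 0 < A.
Hypothesis B_gt0 : 0 < B.
Hypothesis A_stable : stable_f_ge A c.
Hypothesis offset_IH : forall B' A' c', 0 < B' < B -> 0 < A' -> stable_f_ge A' c' ->
  offset_f_ge A' B' (c' + 1)%R.

Lemma rho_offset_le m : ((f (A * 3 ^ m + B))%:Z <= c + (3 * m)%:Z)%R ->
  (rho (A * 3 ^ m + B) <= (3 ^ f A)%:R)%R.
Proof.
have := A_stable 0; rewrite muln1 => c_le f_le.
have le_n : 3 ^ m <= A * 3 ^ m + B by rewrite (leq_trans (leq_pmull _ A_gt0)) ?leq_addr.
have n_gt0 : 0 < A * 3 ^ m + B by rewrite addn_gt0 B_gt0 orbT.
rewrite /rho ler_pdivrMr ?exprn_gt0 ?ltr0n // -!natrX -natrM ler_nat.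
apply: (@leq_trans (3 ^ (f A + 3 * m))); first by rewrite leq_exp2l //; lia.
by rewrite expnD leq_mul2l mulnC expnM leq_exp2r // le_n orbT.
Qed.

Lemma stable_f_cofactor u A' G : 0 < u -> 0 < A' -> u * A' = A * 3 ^ G ->
  stable_f_ge A' (c + (3 * G)%:Z - (f u)%:Z)%R.
Proof.
move=> u_gt0 A'_gt0 uA'E k; have := A_stable (G + k).
have := @f_mul_le u (A' * 3 ^ k) u_gt0; rewrite muln_gt0 A'_gt0 expn_gt0 => /(_ isT).
by rewrite mulnA uA'E -mulnA -expnD; lia.
Qed.

Lemma offset_cofactor_ge G C : eventually (fun m => forall u, u <= C -> forall A' B',
  1 < u -> u * B' = B -> u * A' = A * 3 ^ G ->
  (c + 1 + (3 * (m + G))%:Z <= (f u + f (A' * 3 ^ m + B'))%:Z)%R).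
Proof.
apply: eventually_forall_le => u.
have [/and3P[u_gt1 /dvdnP[B1 BE] /dvdnP[A1 AE]]|no_cofactor] :=
  boolP [&& 1 < u, u %| B & u %| A * 3 ^ G]; last first.
  exists 0 => m _ A' B' u_gt1 uB'E uA'E.
  by case/negP: no_cofactor; rewrite u_gt1 -uA'E -{1}uB'E !dvdn_mulr.
have u_gt0 := ltnW u_gt1; rewrite [_ * u]mulnC in AE; rewrite [_ * u]mulnC in BE.
have B1_gt0 : 0 < B1 by move: B_gt0; rewrite BE muln_gt0 => /andP[].
have A1_gt0 : 0 < A1.
  have : 0 < A * 3 ^ G by rewrite muln_gt0 A_gt0 expn_gt0.
  by rewrite AE muln_gt0 => /andP[].
have B1_range : 0 < B1 < B by rewrite B1_gt0 BE ltn_Pmull.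
have [M offset_M] := offset_IH B1_range A1_gt0 (stable_f_cofactor u_gt0 A1_gt0 (esym AE)).
exists M => m /offset_M f_ge A' B' _ uB'E uA'E.
have -> : B' = B1 by apply/eqP; rewrite -(eqn_pmul2l u_gt0) uB'E BE.
have -> : A' = A1 by apply/eqP; rewrite -(eqn_pmul2l u_gt0) uA'E AE.
by lia.
Qed.

Lemma offset_smaller_ge : eventually (fun m => forall v, v <= B -> 0 < v < B ->
  (c + 1 + (3 * m)%:Z <= (f (A * 3 ^ m + (B - v)))%:Z)%R).
Proof.
apply: eventually_forall_le => v.
have [/andP[v_gt0 lt_vB]|] := boolP (0 < v < B); last by exists 0.
have [|M offset_M] := @offset_IH (B - v) A c _ A_gt0 A_stable; first by lia.
by exists M => m /offset_M.
Qed.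

Lemma offset_product_ge D : eventually (fun m => forall x y, 1 < x -> 1 < y ->
  A * 3 ^ m + B = x * y -> f (A * 3 ^ m + B) = f x + f y -> sparse 3 D x -> sparse 3 D y ->
  (c + 1 + (3 * m)%:Z <= (f (A * 3 ^ m + B))%:Z)%R).
Proof.
have [M1 [G [C factor]]] := @sparse_factor 3 isT D A B B_gt0.
have [M2 cofactor] := offset_cofactor_ge G C.
exists (M1 + G + M2) => m m_big x y x_gt1 y_gt1 nE fE x_sparse y_sparse.
have [||u [w [A' [B' [uwE u_le wE uB'E uA'E]]]]] := factor m x y _ x_sparse y_sparse.
- by lia.
- by rewrite nE.
have [u_gt1 fuwE] : 1 < u /\ f u + f w = f x + f y.
  by case: uwE => -[-> ->]; split=> //; rewrite addnC.
have le_M2 : M2 <= m - G by lia.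
have := cofactor _ le_M2 u u_le A' B' u_gt1 uB'E uA'E.
by rewrite -wE subnK ?fuwE -?fE //; lia.
Qed.

(* A summand [v] beyond [B] would leave [A * 3 ^ m] as a sum of few powers of 3, one of
   which is 1. *)
Lemma offset_sum_ge D V : eventually (fun m => forall x v, 0 < v <= V ->
  A * 3 ^ m + B = x + v -> f (A * 3 ^ m + B) = f x + f v -> sparse 3 D x ->
  (c + 1 + (3 * m)%:Z <= (f (A * 3 ^ m + B))%:Z)%R).
Proof.
have [M smaller] := offset_smaller_ge.
exists (M + D + V).+1 => m m_big x v /andP[v_gt0 v_le] nE -> x_sparse.
have fv_gt0 := f_gt0 v_gt0; have [lt_vB|lt_Bv|vB] := ltngtP v B.
- have le_Mm : M <= m by lia.
  have := smaller m le_Mm v (ltnW lt_vB); rewrite v_gt0 lt_vB => /(_ isT).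
  have -> : A * 3 ^ m + (B - v) = x by lia.
  by lia.
- case: x_sparse nE => s s_size -> nE.
  have powsumE : powsum 3 (nseq (v - B) 0 ++ s) = A * 3 ^ m + 0.
    by rewrite /powsum big_cat /= -!/(powsum 3 _) powsum_nseq0; lia.
  have mem0 : 0 \in nseq (v - B) 0 ++ s by rewrite mem_cat mem_nseq subn_gt0 lt_Bv.
  have := powsum_gap (isT : 1 < 3) powsumE mem0 isT; rewrite size_cat size_nseq.
  by lia.
have -> : x = A * 3 ^ m by lia.
by have := A_stable m; lia.
Qed.

Lemma offset_step : offset_f_ge A B (c + 1)%R.
Proof.
pose r := 3 ^ f A; have [D bounded_sparse] := rho_le_sparse (r * 8).
have [M1 product_ge] := offset_product_ge D.
have [M2 sum_ge] := offset_sum_ge D (2 * r).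
exists (M1 + M2) => m m_big; set n := A * 3 ^ m + B.
wlog f_lt : / ((f n)%:Z < c + 1 + (3 * m)%:Z)%R.
  by move=> f_ge; rewrite leNgt; apply/negP => f_lt; have := f_ge f_lt; rewrite leNgt f_lt.
have rho_n : (rho n <= r%:R)%R by apply: rho_offset_le; rewrite -/n; lia.
have n_gt1 : 1 < n by rewrite /n -addn1 leq_add // muln_gt0 A_gt0 expn_gt0.
have rho_n_ge1 := rho_ge1 (ltnW n_gt1).
case: (f_optimal_split n_gt1) => [x v v_gt0 le_vx nE fE|x y x_gt1 y_gt1 nE fE].
  have v_range : 0 < v <= x by rewrite v_gt0.
  rewrite nE in fE rho_n rho_n_ge1; have x_gt0 := leq_trans v_gt0 le_vx.
  apply: (sum_ge m _ x v); rewrite -/n ?nE //; first by lia.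
    by rewrite v_gt0 (optimal_summand_le v_range fE).
  apply: bounded_sparse => //; have := rho_summand_le8 v_range fE.
  by rewrite natrM; lra.
have [rho_x rho_y] := (rho_ge1 (ltnW x_gt1), rho_ge1 (ltnW y_gt1)).
rewrite (rho_mul nE fE) in rho_n.
by apply: (product_ge m _ x y) => //; [lia| |]; apply: bounded_sparse;
  rewrite ?(ltnW x_gt1) ?(ltnW y_gt1) // natrM; nra.
Qed.

End OffsetStep.

Theorem f_offset_ge A B c : 0 < A -> 0 < B -> stable_f_ge A c -> offset_f_ge A B (c + 1)%R.
Proof.
elim/ltn_ind: B A c => B IHB A c A_gt0 B_gt0 A_stable; apply: offset_step => //.
by move=> B' A' c' /andP[B'_gt0 lt_B'B] A'_gt0; exact: IHB.
Qed.

Lemma f_add_mul_le r c n : 0 < r -> 0 < c -> 0 < n ->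
  f (r + r * c * n) <= f r + f c + f n + 1.
Proof.
move=> r_gt0 c_gt0 n_gt0; have cn_gt0 : 0 < c * n by rewrite muln_gt0 c_gt0.
have f_prod := f_mul_le r_gt0 (ltn0Sn (c * n)); have f_cn := f_mul_le c_gt0 n_gt0.
have f_succ := f_add_le (ltn0Sn 0) cn_gt0; rewrite (@f_id 1) // add1n in f_succ.
by rewrite -mulnA -mulnS; lia.
Qed.

Lemma f_add_smooth_mul_le i j r n : 0 < i + j -> i < 40 -> 1 < r -> r < 2 ^ i * 3 ^ j ->
  r %| 2 ^ i * 3 ^ j -> 0 < n ->
  f (r + 2 ^ i * 3 ^ j * n) <= f n + f (2 ^ i * 3 ^ j) + 1.
Proof.
move=> ij_gt0 i_lt40 r_gt1 r_lt /dvdnP[q]; rewrite [q * r]mulnC => bE n_gt0.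
have q_gt1 : 1 < q by move: r_lt; rewrite bE; nia.
have [a [b [d [e [rE qE iE jE]]]]] := smooth_mulP bE.
have factor_exp_gt0 a' b' : 1 < 2 ^ a' * 3 ^ b' -> 0 < a' + b'.
  by case: a' => // ; case: b'.
have f_r := f_smooth_le (factor_exp_gt0 a b _); rewrite -rE in f_r.
have f_q := f_smooth_le (factor_exp_gt0 d e _); rewrite -qE in f_q.
have := f_add_mul_le (ltnW r_gt1) (ltnW q_gt1) n_gt0.
by rewrite f_smooth // bE; have := f_r r_gt1; have := f_q q_gt1; lia.
Qed.

Lemma f_smooth_stable i j : 0 < i + j -> i < 40 ->
  stable_f_ge (2 ^ i * 3 ^ j) (f (2 ^ i * 3 ^ j))%:Z.
Proof.
move=> ij_gt0 i_lt40 k; rewrite -mulnA -expnD f_smooth //.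
by have := @f_smooth_ge i (j + k) i_lt40; lia.
Qed.

Lemma exp10_12_le_exp2_40 : 10 ^ 12 <= 2 ^ 40.
Proof. by rewrite -[12]/(3 * 4) -[40]/(10 * 4) !expnM leq_exp2r. Qed.

Theorem theorem2p1 (i j b r : nat) :
  b = 2 ^ i * 3 ^ j -> 0 < i + j -> b < 10 ^ 12 ->
  2 <= r -> r < b -> r %| b ->
  is_D b r ((f b)%:Z + 1)%R.
Proof.
move=> bE ij_gt0 /leq_trans/(_ exp10_12_le_exp2_40) b_lt r_gt1 r_lt r_dvd.
have i_lt40 : i < 40.
  rewrite -(ltn_exp2l i 40 (isT : 1 < 2)); apply: leq_ltn_trans b_lt.
  by rewrite bE pow2_le_smooth.
split=> [n n_gt0|d d_bound].
  rewrite bE in r_lt r_dvd *.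
  by have := f_add_smooth_mul_le ij_gt0 i_lt40 r_gt1 r_lt r_dvd n_gt0; lia.
have [b_gt0 r_gt0] : 0 < b /\ 0 < r by lia.
have b_stable : stable_f_ge b (f b)%:Z by rewrite bE; exact: f_smooth_stable.
have [M lower] := f_offset_ge b_gt0 r_gt0 b_stable.
have := lower M.+1 (leqnSn M); have := d_bound (3 ^ M.+1); rewrite expn_gt0 f_pow3 //.
by move=> /(_ isT); rewrite addnC; lia.
Qed.
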